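(* Let $M$ be a Klein geometry with transitively acting Lie group $G$, let $\omega\colon A\to\mathfrak g$ be an infinitesimal immersion of a connected manifold $\Sigma$ into $M$, and let $A=A^1\supset A^2\supset A^3\supset\cdots$ be the associated invariant filtration. For all $j\ge1$, $A^j\subset A$ is a subalgebroid. In the case that $A^j$ is transitive, $A^{j+1}$ is the isotropy subalgebroid of $A^j\subset E$ under the restriction of the fundamental representation (of $A$ on $E=\mathfrak g\times\Sigma$) to a representation of $A^j$ on $E$.
   Context: A Klein geometry is a smooth manifold $M$ with a smooth transitive action of a Lie group $G$; $\mathfrak g$ is the Lie algebra of $G$ (bracket defined by right-invariant vector fields), $\mathfrak g_m\subset\mathfrak g$ the isotropy algebra at $m\in M$ of the infinitesimal action. A Lie algebroid morphism $\omega\colon A\to\mathfrak g$, with $A$ a Lie algebroid over the connected manifold $\Sigma$ with anchor $\#$, is an infinitesimal immersion of $\Sigma$ into $M$ if: (I1) $A$ is transitive; (I2) $\omega$ is injective on fibres; (I3) for some (equivalently any) $x_0\in\Sigma$ there is $m_0\in M$ with $\omega(\ker\#|_{x_0})\subset\mathfrak g_{m_0}$; (I4) $\dim\mathfrak g-\operatorname{rank}A=\dim M-\dim\Sigma$. Using $\omega$, $A$ is identified with a subbundle of $E=\mathfrak g\times\Sigma$, on which $\nabla$ is the canonical flat connection and $\{X,Y\}(x)=[X(x),Y(x)]_{\mathfrak g}$; then $[X,Y]=\nabla_{\#X}Y-\nabla_{\#Y}X+\{X,Y\}$ for sections $X,Y$ of $A$. Invariant filtration: $A^1=A$ and, for $j\ge2$,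 $A^j|_x=\{X(x): X\in\Gamma(A^{j-1}),\ \nabla_uX\in A^{j-1}\text{ for all }u\in T_x\Sigma\}$, tacitly assumed of constant rank at each stage. The fundamental representation is the representation $\bar\nabla$ of $A$ on $E$ given by $\bar\nabla_X\xi=\nabla_{\#X}\xi+\{X,\xi\}$, $X\in\Gamma(A)$, $\xi\in\Gamma(E)$. For a representation $\bar\nabla$ of a Lie algebroid $B$ on a vector bundle $V$ and a subbundle $W\subset V$, the isotropy of $W$ is $\{b\in B:\bar\nabla_b\eta\in W\text{ for all sections }\eta\text{ of }W\}$. *)

(* Defs.v *)
From mathcomp Require Export all_boot all_order all_algebra.
From mathcomp Require Export all_classical all_reals all_analysis.
Export Order.TTheory GRing.Theory Num.Theory.
Export numFieldNormedType.Exports.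
Set Implicit Arguments.
Unset Strict Implicit.
Unset Printing Implicit Defensive.
Local Open Scope classical_set_scope.
Local Open Scope ring_scope.

(* For V finite-dimensional and U open, f is C^(k+1) on U iff it is continuous
   and all its directional derivatives exist and are C^k on U. *)
Fixpoint Ck (R : realType) (V W : normedModType R) (k : nat) (U : set V)
    (f : V -> W) : Prop :=
  (forall x, U x -> {for x, continuous f}) /\
  (if k is k'.+1 then
     forall v, (forall x, U x -> derivable f x v) /\
               Ck k' U (fun x => 'D_v f x : W)
   else True).

Definition smooth_on (R : realType) (V W : normedModType R) (U : set V)
    (f : V -> W) : Prop :=
  forall k, Ck k U f.

(* A chart is stored with total maps; cmap is relevant only on cdom, and cinv
   only on the image of cdom. *)
Record chart (R : realType) (T : topologicalType) (n : nat) := Chart {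
  cdom : set T;
  cmap : T -> 'rV[R]_n;
  cinv : 'rV[R]_n -> T }.

Definition chart_homeo (R : realType) (T : topologicalType) (n : nat)
    (c : chart R T n) : Prop :=
  [/\ open (cdom c), open (cmap c @` cdom c),
      forall x, cdom c x -> cinv c (cmap c x) = x,
      forall x, cdom c x -> {for x, continuous (cmap c)} &
      forall p, (cmap c @` cdom c) p -> {for p, continuous (cinv c)}].

Record manifold (R : realType) := Manifold {
  mcar :> topologicalType;
  mdim : nat;
  atlas : set (chart R mcar mdim);
  m_hausdorff : hausdorff_space mcar;
  m_countable : @second_countable mcar;
  m_charts : forall c, atlas c -> chart_homeo c;
  m_cover : forall x, exists2 c, atlas c & cdom c x;
  m_compat : forall c c', atlas c -> atlas c' ->
    smooth_on (cmap c @` (cdom c `&` cdom c')) (cmap c' \o cinv c) }.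

Definition smooth_map (R : realType) (M N : manifold R) (f : M -> N) : Prop :=
  continuous f /\
  forall c d, atlas c -> atlas d ->
    smooth_on (cmap c @` (cdom c `&` f @^-1` cdom d)) (cmap d \o f \o cinv c).

(* Smoothness of a map on the product manifold, in product charts. *)
Definition smooth_map2 (R : realType) (M N P : manifold R) (f : M -> N -> P)
    : Prop :=
  continuous (fun z : M * N => f z.1 z.2) /\
  forall c c' d, atlas c -> atlas c' -> atlas d ->
    smooth_on
      ((fun z : M * N => (cmap c z.1, cmap c' z.2)) @`
        [set z | [/\ cdom c z.1, cdom c' z.2 & cdom d (f z.1 z.2)]])
      (fun p => cmap d (f (cinv c p.1) (cinv c' p.2))).

Definition smoothf_on (R : realType) (M : manifold R) (U : set M) (f : M -> R)
    : Prop :=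
  forall c, atlas c ->
    smooth_on (cmap c @` (cdom c `&` U)) (f \o cinv c).

Definition smoothf (R : realType) (M : manifold R) (f : M -> R) : Prop :=
  smoothf_on [set: M] f.

(* Tangent vectors are derivations of the smooth functions at a point.  They are
   represented by maps on all functions, whose values are relevant only on
   smooth functions; accordingly they are never compared by Leibniz equality. *)
Definition is_tangent (R : realType) (M : manifold R) (x : M)
    (u : (M -> R) -> R) : Prop :=
  (forall (a : R) f g, smoothf f -> smoothf g ->
     u (fun y => a * f y + g y) = a * u f + u g) /\
  (forall f g, smoothf f -> smoothf g ->
     u (fun y => f y * g y) = f x * u g + g x * u f).

Definition is_vector_field (R : realType) (M : manifold R)
    (X : M -> (M -> R) -> R) : Prop :=
  (forall x, is_tangent x (X x)) /\
  (forall f, smoothf f -> smoothf (fun x => X x f)).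

Record lie_group (R : realType) := LieGroup {
  lg_car :> manifold R;
  lg_mul : lg_car -> lg_car -> lg_car;
  lg_one : lg_car;
  lg_inv : lg_car -> lg_car;
  lg_mulA : associative lg_mul;
  lg_mul1 : left_id lg_one lg_mul;
  lg_mulV : left_inverse lg_one lg_inv lg_mul;
  lg_mul_smooth : smooth_map2 lg_mul;
  lg_inv_smooth : smooth_map lg_inv }.

Definition is_right_invariant (R : realType) (G : lie_group R)
    (X : G -> (G -> R) -> R) : Prop :=
  is_vector_field X /\
  forall (h k : G) f, smoothf f ->
    X (lg_mul h k) f = X h (fun y => f (lg_mul y k)).

(* The Lie algebra of G: a vector space la_car with a linear isomorphism la_vf
   onto the right-invariant vector fields on G, carrying la_br to their
   commutator. *)
Record lie_algebra (R : realType) (G : lie_group R) := LieAlgebra {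
  la_car :> vectType R;
  la_br : la_car -> la_car -> la_car;
  la_vf : la_car -> G -> (G -> R) -> R;
  la_vf_linear : forall (a : R) xi eta y f, smoothf f ->
    la_vf (a *: xi + eta) y f = a * la_vf xi y f + la_vf eta y f;
  la_vf_inj : forall xi,
    (forall y f, smoothf f -> la_vf xi y f = 0) -> xi = 0;
  la_vf_invariant : forall xi, is_right_invariant (la_vf xi);
  la_vf_onto : forall X, is_right_invariant X ->
    exists xi, forall y f, smoothf f -> X y f = la_vf xi y f;
  la_vf_br : forall xi eta y f, smoothf f ->
    la_vf (la_br xi eta) y f =
      la_vf xi y (fun z => la_vf eta z f) - la_vf eta y (fun z => la_vf xi z f) }.

Record klein_geometry (R : realType) (G : lie_group R) := KleinGeometry {
  kg_car :> manifold R;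
  kg_act : G -> kg_car -> kg_car;
  kg_act1 : forall m, kg_act (lg_one G) m = m;
  kg_actM : forall h k m, kg_act (lg_mul h k) m = kg_act h (kg_act k m);
  kg_act_smooth : smooth_map2 kg_act;
  kg_transitive : forall m m', exists h, kg_act h m = m' }.

(* xi in g acts at m by the pushforward of xi at the identity under h |-> h m. *)
Definition isotropy_algebra (R : realType) (G : lie_group R)
    (g : lie_algebra G) (M : klein_geometry G) (m : M) : set g :=
  [set xi | forall f : M -> R, smoothf f ->
     la_vf xi (lg_one G) (fun h => f (kg_act h m)) = 0].

(* A local trivialization, given by its frame; fr is relevant only on fdom. *)
Record local_frame (R : realType) (S : manifold R) (fib : S -> vectType R)
    (r : nat) := LocalFrame {
  fdom : set S;
  fr : forall x, r.-tuple (fib x) }.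

Definition smooth_in_frames (R : realType) (S : manifold R)
    (fib : S -> vectType R) (r : nat) (F : set (local_frame fib r)) (U : set S)
    (s : forall x, fib x) : Prop :=
  forall e, F e -> forall i : 'I_r,
    smoothf_on (U `&` fdom e) (fun x => coord (fr e x) i (s x)).

Record vbundle (R : realType) (S : manifold R) := VBundle {
  fib :> S -> vectType R;
  rank : nat;
  frames : set (local_frame fib rank);
  vb_open : forall e, frames e -> open (fdom e);
  vb_basis : forall e x, frames e -> fdom e x -> basis_of fullv (fr e x);
  vb_cover : forall x, exists2 e, frames e & fdom e x;
  vb_compat : forall e (i : 'I_rank), frames e ->
    smooth_in_frames frames (fdom e) (fun x => tnth (fr e x) i) }.

Definition sect (R : realType) (S : manifold R) (V : vbundle S) :=
  forall x, V x.

Definition smooth_sect_on (R : realType) (S : manifold R) (V : vbundle S)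
    (U : set S) (s : sect V) : Prop :=
  smooth_in_frames (@frames _ _ V) U s.

Definition smooth_sect (R : realType) (S : manifold R) (V : vbundle S)
    (s : sect V) : Prop :=
  smooth_sect_on [set: S] s.

Definition subfamily (R : realType) (S : manifold R) (V : vbundle S) :=
  forall x, set (V x).

Definition sect_in (R : realType) (S : manifold R) (V : vbundle S)
    (W : subfamily V) (s : sect V) : Prop :=
  smooth_sect s /\ forall x, W x (s x).

Definition constant_rank (R : realType) (S : manifold R) (V : vbundle S)
    (W : subfamily V) : Prop :=
  exists k : nat, forall x,
    exists2 H : {vspace V x}, \dim H = k & W x = [set v | v \in H].

Definition is_subbundle (R : realType) (S : manifold R) (V : vbundle S)
    (W : subfamily V) : Prop :=
  exists k : nat, forall x0, exists (U : set S) (e : forall x, k.-tuple (V x)),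
    [/\ open U, U x0,
        forall i, smooth_sect_on U (fun x => tnth (e x) i) &
        forall x, U x -> free (e x) /\ W x = [set v | v \in <<e x>>%VS]].

Lemma Ck_cst (R : realType) (V W : normedModType R) (k : nat) (U : set V)
  (w : W) : Ck k U (fun=> w).
Proof.
elim: k w => [|k IH] w; split=> //; first by move=> x _; exact: cst_continuous.
  by move=> x _; exact: cst_continuous.
move=> v; split=> [x _|]; first exact: derivable_cst.
rewrite (_ : (fun x => _) = (fun=> 0 : W)); first exact: IH.
by apply: boolp.funext => x; exact: derive_cst.
Qed.

Section TrivialBundle.
Context (R : realType) (S : manifold R) (g : vectType R).

Definition trivial_frame : local_frame (fun _ : S => g) (\dim {:g}) :=
  LocalFrame [set: S] (fun=> vbasis {:g}).

Definition trivial_bundle : vbundle S.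
Proof.
apply: (@VBundle R S (fun=> g) _ [set trivial_frame]).
- by move=> e ->; exact: openT.
- by move=> e x -> _; exact: vbasisP.
- by move=> x; exists trivial_frame.
- move=> e i -> e' -> j c _ k.
  set w := coord (vbasis {:g}) j (tnth (vbasis {:g}) i).
  exact: (Ck_cst _ _ w).
Defined.
End TrivialBundle.

Arguments trivial_bundle {R} S g.

Record lie_algebroid (R : realType) (S : manifold R) := LieAlgebroid {
  ad_bundle :> vbundle S;
  anchor : forall x, ad_bundle x -> (S -> R) -> R;
  ad_br : sect ad_bundle -> sect ad_bundle -> sect ad_bundle;
  anchor_tangent : forall x (a : ad_bundle x), is_tangent x (anchor a);
  anchor_linear : forall x (c : R) (a b : ad_bundle x) f, smoothf f ->
    anchor (c *: a + b) f = c * anchor a f + anchor b f;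
  anchor_smooth : forall e (i : 'I_(rank ad_bundle)) f, frames e -> smoothf f ->
    smoothf_on (fdom e) (fun x => anchor (tnth (fr e x) i) f);
  ad_br_smooth : forall X Y, smooth_sect X -> smooth_sect Y ->
    smooth_sect (ad_br X Y);
  ad_br_linear : forall (c : R) X Y Z,
    smooth_sect X -> smooth_sect Y -> smooth_sect Z ->
    ad_br (fun x => c *: X x + Y x) Z =
      fun x => c *: ad_br X Z x + ad_br Y Z x;
  ad_br_anti : forall X Y, smooth_sect X -> smooth_sect Y ->
    ad_br X Y = fun x => - ad_br Y X x;
  ad_br_jacobi : forall X Y Z,
    smooth_sect X -> smooth_sect Y -> smooth_sect Z -> forall x,
    ad_br X (ad_br Y Z) x + ad_br Y (ad_br Z X) x + ad_br Z (ad_br X Y) x = 0;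
  ad_br_leibniz : forall (f : S -> R) X Y,
    smoothf f -> smooth_sect X -> smooth_sect Y -> forall x,
    ad_br X (fun y => f y *: Y y) x =
      f x *: ad_br X Y x + anchor (X x) f *: Y x;
  anchor_br : forall X Y f, smooth_sect X -> smooth_sect Y -> smoothf f ->
    forall x, anchor (ad_br X Y x) f =
      anchor (X x) (fun y => anchor (Y y) f) -
      anchor (Y x) (fun y => anchor (X y) f) }.

Definition transitive_on (R : realType) (S : manifold R) (A : lie_algebroid S)
    (B : subfamily A) : Prop :=
  forall (x : S) u, is_tangent x u ->
    exists2 b : A x, B x b & forall f, smoothf f -> anchor b f = u f.

Definition is_transitive (R : realType) (S : manifold R) (A : lie_algebroid S)
    : Prop :=
  transitive_on (fun x => [set: A x]).

Definition is_subalgebroid (R : realType) (S : manifold R)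
    (A : lie_algebroid S) (B : subfamily A) : Prop :=
  is_subbundle B /\
  forall X Y, sect_in B X -> sect_in B Y -> sect_in B (ad_br X Y).

Definition connection_op (R : realType) (S : manifold R) (A : lie_algebroid S)
    (V : vbundle S) :=
  forall x, A x -> sect V -> V x.

(* The restriction of D to the subalgebroid B of A is a representation of B
   on V. *)
Definition represents (R : realType) (S : manifold R) (A : lie_algebroid S)
    (V : vbundle S) (B : subfamily A) (D : connection_op A V) : Prop :=
  [/\ forall X xi, sect_in B X -> smooth_sect xi ->
        smooth_sect (fun x => D x (X x) xi),
      forall x (c : R) a b xi, B x a -> B x b -> smooth_sect xi ->
        D x (c *: a + b) xi = c *: D x a xi + D x b xi,
      forall x b xi eta, B x b -> smooth_sect xi -> smooth_sect eta ->
        D x b (fun y => xi y + eta y) = D x b xi + D x b eta,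
      forall x b (f : S -> R) xi, B x b -> smoothf f -> smooth_sect xi ->
        D x b (fun y => f y *: xi y) = f x *: D x b xi + anchor b f *: xi x &
      forall X Y xi, sect_in B X -> sect_in B Y -> smooth_sect xi -> forall x,
        D x (ad_br X Y x) xi =
          D x (X x) (fun y => D y (Y y) xi) - D x (Y x) (fun y => D y (X y) xi)].

Definition isotropy (R : realType) (S : manifold R) (A : lie_algebroid S)
    (V : vbundle S) (B : subfamily A) (D : connection_op A V)
    (W : subfamily V) : subfamily A :=
  fun x => [set b | B x b /\ forall eta, sect_in W eta -> W x (D x b eta)].
Arguments isotropy {R S A V} B D W x _.

(* The derivative along u of a function with values in the vector space g, i.e.
   the canonical flat connection on the trivial bundle g x S. *)
Definition flat (R : realType) (S : manifold R) (g : vectType R)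
    (u : (S -> R) -> R) (xi : S -> g) : g :=
  \sum_(i < \dim {:g})
    u (fun y => coord (vbasis {:g}) i (xi y)) *: tnth (vbasis {:g}) i.

Definition is_algebroid_morphism (R : realType) (G : lie_group R)
    (g : lie_algebra G) (S : manifold R) (A : lie_algebroid S)
    (omega : forall x, 'Hom(A x, g)) : Prop :=
  (forall e (i : 'I_(rank A)), frames e ->
     @smooth_sect_on _ _ (trivial_bundle S g) (fdom e)
       (fun x => omega x (tnth (fr e x) i))) /\
  (forall X Y : sect A, smooth_sect X -> smooth_sect Y -> forall x,
     omega x (ad_br X Y x) =
       flat (anchor (X x)) (fun y => omega y (Y y))
       - flat (anchor (Y x)) (fun y => omega y (X y))
       + la_br (omega x (X x)) (omega x (Y x))).

Record is_infinitesimal_immersion (R : realType) (G : lie_group R)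
    (g : lie_algebra G) (M : klein_geometry G) (S : manifold R)
    (A : lie_algebroid S) (omega : forall x, 'Hom(A x, g)) : Prop :=
  InfinitesimalImmersion {
  ii_morphism : is_algebroid_morphism omega;
  ii_transitive : is_transitive A;
  ii_injective : forall x, injective (omega x);
  ii_isotropy : exists (x0 : S) (m0 : M), forall a : A x0,
    (forall f, smoothf f -> anchor a f = 0) ->
    isotropy_algebra m0 (omega x0 a);
  ii_dim : (\dim {:g})%:Z - (rank A)%:Z = (mdim M)%:Z - (mdim S)%:Z }.

(* The subset of E = g x S with which omega identifies W. *)
Definition omega_image (R : realType) (G : lie_group R) (g : lie_algebra G)
    (S : manifold R) (A : lie_algebroid S) (omega : forall x, 'Hom(A x, g))
    (W : subfamily A) : subfamily (trivial_bundle S g) :=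
  fun x => omega x @` W x.
Arguments omega_image {R G g S A} omega W x _.

Definition filtration_step (R : realType) (G : lie_group R)
    (g : lie_algebra G) (S : manifold R) (A : lie_algebroid S)
    (omega : forall x, 'Hom(A x, g)) (W : subfamily A) : subfamily A :=
  fun x => [set v | exists X : sect A,
    [/\ sect_in W X, X x = v &
        forall u, is_tangent x u ->
          omega_image omega W x (flat u (fun y => omega y (X y)))]].
Arguments filtration_step {R G g S A} omega W x _.

(* Indexed from 1; the value at 0 is a dummy, equal to that at 1. *)
Definition invariant_filtration (R : realType) (G : lie_group R)
    (g : lie_algebra G) (S : manifold R) (A : lie_algebroid S)
    (omega : forall x, 'Hom(A x, g)) (j : nat) : subfamily A :=
  iter j.-1 (filtration_step omega) (fun x => [set: A x]).
Arguments invariant_filtration {R G g S A} omega j x _.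

Definition fundamental_rep (R : realType) (G : lie_group R)
    (g : lie_algebra G) (S : manifold R) (A : lie_algebroid S)
    (omega : forall x, 'Hom(A x, g)) : connection_op A (trivial_bundle S g) :=
  fun x a xi => flat (anchor a) xi + la_br (omega x a) (xi x).
Arguments fundamental_rep {R G g S A} omega x a xi.

(* Main.v *)
Require Import Defs.
From mathcomp Require Import ring lra.
Local Open Scope classical_set_scope.
Local Open Scope ring_scope.
Set Implicit Arguments.
Unset Strict Implicit.
Unset Printing Implicit Defensive.

(** Identify A with its image in E = g x S.  If W is a subbundle of A, then for a
    section X of W the class of nabla_u X modulo W depends only on X(x) and u, so
    the next term of the filtration is the kernel of the second fundamental form
    W -> Hom(TS, E/W), and constancy of its rank makes it a subbundle.  Since A is
    transitive, every tangent vector is the anchor of an element of A, so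
    Hom(TS, E/W) may be replaced by Hom(A, E/W) and no coordinate vector fields are
    needed.  Closure under brackets goes by induction: flatness of nabla gives,
    modulo W, nabla_U [X, Y] = [X, nabla_U Y] + [nabla_U X, Y].  Finally
    D_X Y = [X, Y] + nabla_{#Y} X for the fundamental representation D, so that
    X stabilises W at x iff nabla_{#Y} X lies in W for all Y in W, and
    transitivity of W turns #Y into an arbitrary tangent vector. *)

(** * Functions of class C^k *)

(** Two features of the definitions shape the proof. Tangent vectors are derivations of functions
    smooth on the whole manifold, and the filtration and the isotropy quantify over global sections;
    so local frames and local coefficients cannot be differentiated or inserted as they stand. They
    are first multiplied by a bump function, and this also takes the place of locality of
    derivations. Since smoothness is defined by iterated directional derivatives, the bump is built
    up from exp(-1/t).

    The other feature is that the fibres of A vary with the point. Smoothness in A is therefore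
    tested after applying [omega]: by injectivity, frames of A become linearly independent g-valued
    functions, and coefficients, brackets and derivatives are computed in one fixed basis of g.
    There the flatness of nabla is just the axiom [anchor_br], coordinate by coordinate. *)

Section FlatFunction.
Variable R : realType.
Implicit Types (n : nat) (t : R).

(* This family is closed under differentiation, so its smoothness follows by
   induction on the order, for all n at once. *)
Definition expNinv n t : R := if 0 < t then t ^- n * expR (- t^-1) else 0.

(** A single term of the exponential series suffices: exp(1/t) is at least (1/t)^(n+1) / (n+1)!. *)
Lemma expNinv_bound n t : `|expNinv n t| <= (n.+1)`!%:R * `|t|.
Proof.
rewrite /expNinv; case: ifPn => t0; last by rewrite normr0 mulr_ge0.
rewrite !ger0_norm ?(ltW t0)// ?mulr_ge0 ?invr_ge0 ?exprn_ge0 ?expR_ge0 ?(ltW t0)//.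
have := expR_ge1Dxn n (ltW (_ : 0 < t^-1)); rewrite invr_gt0 => /(_ t0) H.
rewrite expRN ler_pdivrMr ?expR_gt0//.
apply: (@le_trans _ _ ((n.+1)`!%:R * t * (t^-1 ^+ n.+1 / (n.+1)`!%:R))).
  have t1 : t * t^-1 = 1 by rewrite mulfV// lt0r_neq0.
  have f1 : (n.+1)`!%:R * ((n.+1)`!%:R)^-1 = 1 :> R.
    by rewrite mulfV// pnatr_eq0 -lt0n fact_gt0.
  rewrite -exprVn exprS [leRHS](_ : _ = (t * t^-1) * ((n.+1)`!%:R * ((n.+1)`!%:R)^-1)
    * t^-1 ^+ n); last by ring.
  by rewrite t1 f1 !mul1r.
apply: ler_wpM2l; first by rewrite mulr_ge0// ltW.
by apply: le_trans H; rewrite lerDr.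
Qed.

(** For every n the difference quotient at 0 is the next member [expNinv n.+1] of the family, which
    tends to 0 by [expNinv_bound]. *)
Lemma derive_expNinv0 n : derivable (expNinv n) 0 1 /\ 'D_1 (expNinv n) 0 = 0.
Proof.
suff H : (fun h : R => h^-1 *: ((expNinv n \o shift 0) (h *: 1) - expNinv n 0))
  @ 0^' --> (0 : R).
  by split; [apply/cvg_ex; exists 0 | exact: cvg_lim H].
apply/cvgrPdist_le => e e0; near=> h.
have h0 : h != 0 by near: h; exact: nbhs_dnbhs_neq.
rewrite sub0r normrN /= addr0 [_ *: 1]mulr1 /expNinv ltxx subr0.
have -> : h^-1 *: expNinv n h = expNinv n.+1 h.
  rewrite /expNinv /GRing.scale/=; case: ifPn => _; last by rewrite mulr0.
  by rewrite exprS invfM -mulrA.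
apply: le_trans (expNinv_bound _ _) _.
rewrite -ler_pdivlMl ?ltr0n ?fact_gt0//.
near: h; apply: dnbhs0_le; rewrite mulr_gt0// invr_gt0 ltr0n; exact: fact_gt0.
Unshelve. all: by end_near. Qed.

Lemma is_derive_expNinv n t :
  is_derive t 1 (expNinv n) (expNinv n.+2 t - n%:R * expNinv n.+1 t).
Proof.
have [t0|t0|->] := ltgtP t 0.
- rewrite /expNinv ltNge (ltW t0)/= mulr0 subr0.
  apply: (@near_eq_is_derive _ _ _ (cst 0)).
  near=> s; have : s < 0 by near: s; exact: lt_nbhsl.
  by rewrite /= ltNge /expNinv; case: ifP => // /ltW ->.
- pose h (s : R) := s ^- n * expR (- s^-1).
  apply: (@near_eq_is_derive _ _ _ h).
    near=> s; have : 0 < s by near: s; exact: lt_nbhsr.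
    by rewrite /h /expNinv => ->.
  have tn0 : t != 0 by exact: lt0r_neq0.
  have dV : is_derive t 1 (fun s : R => s^-1) (- t ^- 2).
    apply: DeriveDef; first exact: derivableV.
    by rewrite (@deriveV _ _ id)// derive_id /GRing.scale /= mulr1.
  have dE : is_derive t 1 (fun s : R => expR (- s^-1)) (expR (- t^-1) * t ^- 2).
    have dN : is_derive t 1 (fun s : R => - s^-1) (- - t ^- 2) by exact: is_deriveN.
    apply: (is_derive_eq (is_derive1_comp (is_derive_expR _) dN)).
    by rewrite opprK mulrC.
  have dX : is_derive t 1 ((fun s : R => s^-1) ^+ n)
      ((n%:R * t^-1 ^+ n.-1) *: - t ^- 2).
    exact: is_deriveX.
  have -> : h = ((fun s : R => s^-1) ^+ n) * (fun s : R => expR (- s^-1)).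
    by apply/funext => s; rewrite /h -exprVn /=; rewrite exprfctE.
  apply: (is_derive_eq (is_deriveM dX dE)).
  rewrite /expNinv t0 /GRing.scale /=.
  have -> : ((fun s : R => s^-1) ^+ n) t = t ^- n.
    by rewrite -exprVn exprfctE.
  case: (n) => [|k]; first by rewrite !mul0r mulr0 addr0 subr0 expr0 invr1 mul1r mulrC.
  rewrite /= -exprVn -exprVn -!exprVn.
  rewrite !exprS. set a := expR _; set b := t^-1; ring.
- have [d1 d2] := derive_expNinv0 n.
  apply: DeriveDef => //; rewrite d2 /expNinv ltxx mulr0 subr0//.
Unshelve. all: by end_near. Qed.

End FlatFunction.

(** * Gluing and closure properties of [Ck] *)

Section Ck.
Variables (R : realType) (V W : normedModType R).

Lemma Ck_subset k (U U' : set V) (f : V -> W) : U' `<=` U -> Ck k U f -> Ck k U' f.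
Proof.
move=> sU; elim: k f => [|k IH] f [c H]; split; do ?[by move=> x /sU/c];
  move=> // v; have [d /IH Hv] := H v; by split=> // x /sU/d.
Qed.

(** [Ck] speaks of continuity and derivatives of a total function at each single point of the set,
    so it can be checked point by point, with any sets U' that contain the points. *)
Lemma Ck_local k (U : set V) (f : V -> W) :
  (forall x, U x -> exists2 U' : set V, U' x & Ck k U' f) -> Ck k U f.
Proof.
elim: k f => [|k IH] f H; split=> //.
- by move=> x /H[U' U'x [+ _]]; exact.
- by move=> x /H[U' U'x [+ _]]; exact.
move=> v; split; first by move=> x /H[U' U'x [_ /(_ v)[+ _]]]; exact.
by apply: IH => x /H[U' U'x [_ /(_ v)[_ ?]]]; exists U'.
Qed.

Lemma Ck_eq k (U : set V) (f h : V -> W) :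
  open U -> (forall x, U x -> f x = h x) -> Ck k U f -> Ck k U h.
Proof.
move=> oU; elim: k f h => [|k IH] f h fh [c H].
  split=> // x Ux; rewrite /prop_for /continuous_at -(fh x Ux).
  apply: cvg_trans (c x Ux); apply: near_eq_cvg.
  by have := open_nbhs_nbhs (conj oU Ux); apply: filterS => y; exact: fh.
have nfh x : U x -> \near x, f x = h x.
  by move=> Ux; have := open_nbhs_nbhs (conj oU Ux); apply: filterS => y; exact: fh.
split=> [x Ux|].
  rewrite /prop_for /continuous_at -(fh x Ux).
  by apply: cvg_trans (c x Ux); apply: near_eq_cvg; exact: nfh.
move=> v; have [d Hv] := H v; split.
  by move=> x Ux; exact: near_eq_derivable (nfh x Ux) (d x Ux).
by apply: IH Hv => x Ux; exact: near_eq_derive (nfh x Ux).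
Qed.

Lemma CkS k (U : set V) (f : V -> W) : Ck k.+1 U f -> Ck k U f.
Proof.
elim: k f => [|k IH] f [c H]; split=> // v.
by have [d /IH] := H v.
Qed.

End Ck.

Section CkReal.
Variables (R : realType) (V : normedModType R) (U : set V) (oU : open U).
Implicit Types (f h : V -> R) (k : nat).

Lemma Ck_add k f h : Ck k U f -> Ck k U h -> Ck k U (fun x => f x + h x).
Proof.
elim: k f h => [|k IH] f h [cf Hf] [ch Hh].
  by split=> // x Ux; apply: cvgD; [exact: cf | exact: ch].
split=> [x Ux|v]; first by apply: cvgD; [exact: cf | exact: ch].
have [df Hfv] := Hf v; have [dh Hhv] := Hh v.
split=> [x Ux|]; first exact: derivableD (df _ Ux) (dh _ Ux).
by apply: (Ck_eq oU) (IH _ _ Hfv Hhv) => x Ux; rewrite deriveD//;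
  [exact: df | exact: dh].
Qed.

Lemma Ck_mul k f h : Ck k U f -> Ck k U h -> Ck k U (fun x => f x * h x).
Proof.
elim: k f h => [|k IH] f h Hf' Hh'; move: (Hf') (Hh') => [cf Hf] [ch Hh].
  by split=> // x Ux; apply: cvgM; [exact: cf | exact: ch].
split=> [x Ux|v]; first by apply: cvgM; [exact: cf | exact: ch].
have [df Hfv] := Hf v; have [dh Hhv] := Hh v.
split=> [x Ux|]; first exact: derivableM (df _ Ux) (dh _ Ux).
apply: (Ck_eq oU) (Ck_add (IH _ _ (CkS Hf') Hhv) (IH _ _ (CkS Hh') Hfv)) => x Ux.
by rewrite (@deriveM _ _ f h)//; [exact: df | exact: dh].
Qed.

(** The derivative - f^-2 f' contains only f^-1 and f', so the induction hypothesis on f^-1 supplies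
    the next order. *)
Lemma Ck_inv k f : (forall x, U x -> f x != 0) -> Ck k U f ->
  Ck k U (fun x => (f x)^-1).
Proof.
move=> f0; elim: k => [|k IH] Hf'; move: (Hf') => [cf Hf].
  by split=> // x Ux; apply: cvgV; [exact: f0 | exact: cf].
split=> [x Ux|v]; first by apply: cvgV; [exact: f0 | exact: cf].
have [df Hfv] := Hf v.
split=> [x Ux|]; first exact: derivableV (f0 _ Ux) (df _ Ux).
have fV := IH (CkS Hf').
apply: (Ck_eq oU) (Ck_mul (Ck_mul (Ck_cst k U (- 1 : R)) (Ck_mul fV fV)) Hfv) => x Ux.
rewrite deriveV//; [|exact: f0|exact: df].
by rewrite /GRing.scale /= mulN1r -invfM expr2.
Qed.

Lemma Ck_expNinv k n f : Ck k U f -> Ck k U (fun x => expNinv n (f x)).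
Proof.
elim: k n f => [|k IH] n f Hf'; move: (Hf') => [cf Hf].
  split=> // x Ux; apply: continuous_comp; first exact: cf.
  have [/derivable1_diffP d _] := is_derive_expNinv n (f x).
  exact: differentiable_continuous.
split=> [x Ux|v].
  apply: continuous_comp; first exact: cf.
  have [/derivable1_diffP d _] := is_derive_expNinv n (f x).
  exact: differentiable_continuous.
have [df Hfv] := Hf v.
(* Only directional derivatives of f are at hand, so the chain rule is applied to the real function
   t |-> f (t v + x) at 0. *)
have Hd x : U x -> is_derive x v (fun x => expNinv n (f x))
    ((expNinv n.+2 (f x) - n%:R * expNinv n.+1 (f x)) * 'D_v f x).
  move=> Ux.
  have /derivable1P/derivableP d1 := df x Ux.
  have [d2 e2] := is_derive_expNinv n (f (0 *: v + x)).
  have d3 : is_derive (f (0 *: v + x)) 1 (expNinv n)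
      ('D_1 (expNinv n) (f (0 *: v + x))).
    exact: derivableP.
  have [H1 H2] := is_derive1_comp d3 d1.
  apply: (@DeriveDef _ _ _ _ _ (fun x => expNinv n (f x)));
    first by apply/derivable1P; exact: H1.
  have E (h : V -> R) : 'D_v h x = 'D_1 (fun t : R => h (t *: v + x)) 0.
    rewrite /derive; set h1 := fun s => s^-1 *: _; set h2 := fun s => s^-1 *: _.
    suff -> : h1 = h2 by [].
    by apply/funext => s; rewrite /h1 /h2 /= addr0 scale0r add0r [_ *: 1]mulr1.
  rewrite (E (fun x => expNinv n (f x))) (E f).
  have := H2; rewrite /comp => ->.
  by rewrite e2 scale0r add0r mulrC.
split=> [x /Hd[]//|].
apply: (Ck_eq oU) (Ck_mul (Ck_add (IH n.+2 _ (CkS Hf'))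
  (Ck_mul (Ck_cst k U (- n%:R : R)) (IH n.+1 _ (CkS Hf')))) Hfv) => x /Hd[_ ->].
by rewrite mulNr.
Qed.

Lemma Ck_coord k (p q : nat) (F : V -> 'M[R]_(p, q)) i j :
  Ck k U F -> Ck k U (fun x => F x i j).
Proof.
elim: k F => [|k IH] F [cF HF].
  split=> // x Ux; apply: (@continuous_comp _ _ _ F (fun M : 'M[R]_(p, q) => M i j));
    first exact: cF.
  exact: coord_continuous.
split=> [x Ux|v].
  apply: (@continuous_comp _ _ _ F (fun M : 'M[R]_(p, q) => M i j)); first exact: cF.
  exact: coord_continuous.
have [dF HFv] := HF v.
split=> [x /dF/derivable_mxP//|].
by apply: (Ck_eq oU) (IH _ HFv) => x /dF dx; rewrite derive_mx// mxE.
Qed.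

End CkReal.

(** * Smooth functions on a manifold *)

Section SmoothFunctions.
Variables (R : realType) (M : manifold R).
Implicit Types (U : set M) (f h : M -> R) (x : M).

Lemma open_chart_image (c : chart R M (mdim M)) U :
  atlas c -> open U -> open (cmap c @` (cdom c `&` U)).
Proof.
move=> /m_charts[oc oi ck _ ci] oU; rewrite openE => _ [x [cx Ux] <-].
have ix : (cmap c @` cdom c) (cmap c x) by exists x.
have n1 := open_nbhs_nbhs (conj oi ix).
have n2 : nbhs (cmap c x) (cinv c @^-1` U).
  by apply: (ci _ ix); rewrite /= ck//; exact: open_nbhs_nbhs.
apply: filterS (filterI n1 n2) => _ [[y cy <-]]; rewrite /= ck// => Uy.
by exists y.
Qed.

Lemma smoothf_on_subset U U' f : U' `<=` U -> smoothf_on U f -> smoothf_on U' f.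
Proof.
move=> sU H c ac k; apply: Ck_subset (H c ac k).
by move=> _ [x [cx /sU Ux] <-]; exists x.
Qed.

Lemma smoothf_onW U f : smoothf f -> smoothf_on U f.
Proof. exact: smoothf_on_subset. Qed.

Lemma smoothf_on_local U f :
  (forall x, U x -> exists2 U' : set M, U' x & smoothf_on U' f) -> smoothf_on U f.
Proof.
move=> H c ac k; apply: Ck_local => _ [x [cx /H[U' U'x sU]] <-].
by exists (cmap c @` (cdom c `&` U')); [exists x | exact: sU].
Qed.

Lemma smoothf_on_eq U f h : open U -> (forall x, U x -> f x = h x) ->
  smoothf_on U f -> smoothf_on U h.
Proof.
move=> oU fh H c ac k; apply: Ck_eq (H c ac k); first exact: open_chart_image.
by move=> _ [x [cx Ux] <-] /=; have [_ _ -> // _ _] := m_charts ac; exact: fh.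
Qed.

Lemma smoothf_on_cst U (a : R) : smoothf_on U (fun=> a).
Proof. by move=> c ac k; exact: Ck_cst. Qed.

Lemma smoothf_on_add U f h : open U -> smoothf_on U f -> smoothf_on U h ->
  smoothf_on U (fun x => f x + h x).
Proof.
move=> oU Hf Hh c ac k.
exact: (Ck_add (open_chart_image ac oU) (Hf c ac k) (Hh c ac k)).
Qed.

Lemma smoothf_on_mul U f h : open U -> smoothf_on U f -> smoothf_on U h ->
  smoothf_on U (fun x => f x * h x).
Proof.
move=> oU Hf Hh c ac k.
exact: (Ck_mul (open_chart_image ac oU) (Hf c ac k) (Hh c ac k)).
Qed.

Lemma smoothf_on_opp U f : open U -> smoothf_on U f ->
  smoothf_on U (fun x => - f x).
Proof.
move=> oU Hf; rewrite (_ : (fun x => _) = fun x => - 1 * f x).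
  exact: smoothf_on_mul (smoothf_on_cst _ _) Hf.
by apply/funext => x; rewrite mulN1r.
Qed.

Lemma smoothf_on_inv U f : open U -> (forall x, U x -> f x != 0) ->
  smoothf_on U f -> smoothf_on U (fun x => (f x)^-1).
Proof.
move=> oU f0 Hf c ac k.
apply: (Ck_inv (open_chart_image ac oU) _ (Hf c ac k)).
by move=> _ [x [cx Ux] <-] /=; have [_ _ -> // _ _] := m_charts ac; exact: f0.
Qed.

Lemma smoothf_on_sum U (I : Type) (r : seq I) (F : I -> M -> R) :
  open U -> (forall i, smoothf_on U (F i)) ->
  smoothf_on U (fun x => \sum_(i <- r) F i x).
Proof.
move=> oU HF; elim: r => [|i r IH].
  rewrite (_ : (fun x => _) = fun=> 0); first exact: smoothf_on_cst.
  by apply/funext => x; rewrite big_nil.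
rewrite (_ : (fun x => _) = fun x => F i x + \sum_(j <- r) F j x).
  exact: smoothf_on_add.
by apply/funext => x; rewrite big_cons.
Qed.

Lemma smoothf_on_prod U (I : Type) (r : seq I) (F : I -> M -> R) :
  open U -> (forall i, smoothf_on U (F i)) ->
  smoothf_on U (fun x => \prod_(i <- r) F i x).
Proof.
move=> oU HF; elim: r => [|i r IH].
  rewrite (_ : (fun x => _) = fun=> 1); first exact: smoothf_on_cst.
  by apply/funext => x; rewrite big_nil.
rewrite (_ : (fun x => _) = fun x => F i x * \prod_(j <- r) F j x).
  exact: smoothf_on_mul.
by apply/funext => x; rewrite big_cons.
Qed.

Lemma open_neq0 U f x : open U -> U x -> smoothf_on U f -> f x != 0 ->
  exists V : set M, [/\ open V, V x, V `<=` U & forall y, V y -> f y != 0].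
Proof.
move=> oU Ux sf fx0; have [c ac cx] := m_cover x.
have [oc oi ck cc ci] := m_charts ac.
have fc : {for x, continuous f}.
  have [+ _] := sf c ac 0%N => /(_ (cmap c x)); move=> H.
  have {}H : {for cmap c x, continuous (f \o cinv c)} by apply: H; exists x.
  have H2 := cvg_comp _ _ (cc x cx) H.
  rewrite /prop_for /continuous_at -{2}(ck x cx).
  apply: cvg_trans H2; apply: near_eq_cvg.
  by have := open_nbhs_nbhs (conj oc cx); apply: filterS => y cy /=; rewrite ck.
have n0 : nbhs x (f @^-1` [set t | t != 0]).
  apply: (fc [set t | t != 0]).
  by apply: open_nbhs_nbhs; split=> //; exact: open_neq.
(* Continuity was obtained at x alone, so the set where f does not vanish is only known to be a
   neighbourhood of x; its interior is the open set. *)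
exists (U `&` (f @^-1` [set t | t != 0])^°); split.
- by apply: openI => //; exact: open_interior.
- by split.
- by move=> y [].
- by move=> y [_ /interior_subset].
Qed.

(** In a chart the function is exp(-1/(d^2 - r^2)), r being the Euclidean distance to x, normalised
    at r = 0 and extended by 0. The squared Euclidean distance is smooth, unlike the sup norm of the
    row space. The closed cube of half-side d contains the support and is compact, hence its image K
    is closed in the Hausdorff manifold, not just in the chart. *)
Lemma bump_function U x : open U -> U x ->
  exists (phi : M -> R) (K : set M),
    [/\ smoothf phi, phi x = 1, closed K, K `<=` U & forall y, ~ K y -> phi y = 0].
Proof.
move=> oU Ux; have [c ac cx] := m_cover x.
have [oc oi ck cc ci] := m_charts ac.
have oV := open_chart_image ac oU.
pose p0 := cmap c x.
have /nbhs_ballP[e /= e0 eO] : nbhs p0 (cmap c @` (cdom c `&` U)).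
  by apply: open_nbhs_nbhs; split=> //; exists x.
(* Halving makes the closed cube of half-side d fit into the open sup-norm ball of radius e. *)
pose d := e / 2; have d0 : 0 < d by rewrite divr_gt0.
have de : d < e by rewrite /d ltr_pdivrMr// ltr_pMr// ltr1n.
pose K0 := [set p : 'rV[R]_(mdim M) | forall i,
  [set` `[p0 ord0 i - d, p0 ord0 i + d]] (p ord0 i)].
have cK0 : compact K0.
  apply: (@rV_compact R _ (fun i => [set` `[p0 ord0 i - d, p0 ord0 i + d]])) => i.
  exact: segment_compact.
have K0O : K0 `<=` cmap c @` (cdom c `&` U).
  move=> p Kp; apply: eO; split=> // i j; rewrite (ord1 i) /ball /=.
  move: (Kp j); rewrite /= in_itv /= => /andP[a b].
  by apply: le_lt_trans de; rewrite ler_norml; apply/andP; split; lra.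
pose K := cinv c @` K0.
have cK : compact K.
  apply: continuous_compact cK0; apply: continuous_in_subspaceT => p.
  by rewrite inE => /K0O[y [cy _] <-]; apply: ci; exists y.
have clK : closed K by apply: compact_closed cK; exact: m_hausdorff.
pose q y := d ^+ 2 - \sum_i (cmap c y ord0 i - p0 ord0 i) ^+ 2.
pose phi y : R := if y \in cdom c then expNinv 0 (q y) / expNinv 0 (d ^+ 2) else 0.
have f0 : expNinv 0 (d ^+ 2) != 0.
  by rewrite /expNinv exprn_gt0// expr0 invr1 mul1r expR_eq0.
have phiK y : ~ K y -> phi y = 0.
  move=> Ky; rewrite /phi; case: ifPn => // /set_mem cy.
  rewrite /expNinv; case: ifPn => [q0|]; last by rewrite mul0r.
  case: Ky; exists (cmap c y); last exact: ck.
  move=> i; rewrite /= in_itv /=.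
  (* Each squared coordinate is at most r^2, so the Euclidean ball lies in the cube; this puts y in
     K. *)
  have : (cmap c y ord0 i - p0 ord0 i) ^+ 2 < d ^+ 2.
    rewrite -subr_gt0; apply: lt_le_trans q0 _.
    rewrite /q (bigD1 i)//= lerD2l lerN2 lerDl.
    by apply: sumr_ge0 => k _; exact: sqr_ge0.
  rewrite -ltr_sqrt ?exprn_gt0// !sqrtr_sqr (gtr0_norm d0) ltr_norml => /andP[a b].
  by apply/andP; split; lra.
exists phi, K; split=> //.
- apply: smoothf_on_local => y _.
  have [cy|ncy] := pselect (cdom c y); last first.
    exists (~` K).
      by move=> /= -[p /K0O[z [cz _] <-] zy]; apply: ncy; rewrite -zy ck.
    apply: smoothf_on_eq (smoothf_on_cst _ 0); first exact: closed_openC.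
    by move=> z /= /phiK.
  exists (cdom c) => //.
  apply: (@smoothf_on_eq _ (fun y => expNinv 0 (q y) * (expNinv 0 (d ^+ 2))^-1)) => //.
    by move=> z cz; rewrite /phi mem_set.
  apply: smoothf_on_mul (smoothf_on_cst _ _) => // c' ac' k.
  have oW := open_chart_image ac' oc.
  apply: Ck_expNinv => //=.
  rewrite /q.
  (* Smoothness is tested in an arbitrary chart c', whereas q is written in c: the transition map
     intervenes. *)
  have /= Hq i := Ck_coord oW ord0 i (m_compat ac' ac k).
  have Hqi i := Ck_add oW (Hq i) (Ck_cst k _ (- p0 ord0 i)).
  have Hs : Ck k (cmap c' @` (cdom c' `&` cdom c)) (fun p : 'rV[R]_(mdim M) =>
      \sum_(i <- index_enum 'I_(mdim M)) (cmap c (cinv c' p) ord0 i - p0 ord0 i) ^+ 2).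
    elim: (index_enum _) => [|i r IH].
      rewrite (_ : (fun p => _) = fun=> 0 : R); first exact: Ck_cst.
      by apply/funext => p; rewrite big_nil.
    rewrite (_ : (fun p => _) = fun p : 'rV[R]_(mdim M) =>
      (cmap c (cinv c' p) ord0 i - p0 ord0 i) * (cmap c (cinv c' p) ord0 i - p0 ord0 i)
      + \sum_(j <- r) (cmap c (cinv c' p) ord0 j - p0 ord0 j) ^+ 2).
      by apply: Ck_add => //; exact: Ck_mul.
    by apply/funext => p; rewrite big_cons expr2.
  rewrite (_ : (fun p => _) = (fun p : 'rV[R]_(mdim M) => d ^+ 2 + (-1) *
      \sum_(i <- index_enum 'I_(mdim M)) (cmap c (cinv c' p) ord0 i - p0 ord0 i) ^+ 2)).
    by apply: Ck_add => //; [exact: Ck_cst | apply: Ck_mul => //; exact: Ck_cst].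
  by apply/funext => p; rewrite mulN1r.
- rewrite /phi mem_set// /q big1 ?subr0 ?divff//.
  by move=> i _; rewrite subrr expr0n.
- by move=> _ [p /K0O[y [cy Uy] <-] <-]; rewrite ck.
Qed.

(** U and the complement of K are open and cover the manifold; the product is smooth on the first
    and zero on the second. This is how a local function becomes one that a derivation accepts. *)
Lemma smoothf_bump_mul U K phi f : open U -> closed K -> K `<=` U -> smoothf phi ->
  (forall y, ~ K y -> phi y = 0) -> smoothf_on U f -> smoothf (fun y => phi y * f y).
Proof.
move=> oU cK KU sphi phiK sf; apply: smoothf_on_local => y _.
have [Ky|nKy] := pselect (K y).
  exists U; first exact: KU.
  by apply: smoothf_on_mul => //; exact: smoothf_onW.
exists (~` K) => //; apply: smoothf_on_eq (smoothf_on_cst _ 0).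
  exact: closed_openC.
by move=> z /= /phiK ->; rewrite mul0r.
Qed.

Section Tangent.
Variables (x : M) (u : (M -> R) -> R) (tu : is_tangent x u).

Lemma tangentD f h : smoothf f -> smoothf h -> u (fun y => f y + h y) = u f + u h.
Proof.
move=> sf sh; rewrite -[u f]mul1r -(tu.1 1 f h)//; congr u.
by apply/funext => y; rewrite mul1r.
Qed.

Lemma tangentM f h : smoothf f -> smoothf h ->
  u (fun y => f y * h y) = f x * u h + h x * u f.
Proof. exact: tu.2. Qed.

(** From 1 = 1 * 1 the Leibniz rule gives u 1 = 2 u 1; the constant a is then written as (a - 1) * 1
    + 1 to fit the linearity axiom. *)
Lemma tangent_cst (a : R) : u (fun=> a) = 0.
Proof.
have s1 : smoothf (fun _ : M => 1 : R) by exact: smoothf_on_cst.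
have u1 : u (fun=> 1) = 0.
  have := tangentM s1 s1; rewrite !mul1r => /eqP.
  by rewrite -subr_eq subrr => /eqP <-.
have := tu.1 (a - 1) (fun=> 1) (fun=> 1) s1 s1; rewrite u1 mulr0 addr0 => <-.
by congr u; apply/funext => y; rewrite mulr1 subrK.
Qed.

Lemma tangentZ (a : R) f : smoothf f -> u (fun y => a * f y) = a * u f.
Proof.
move=> sf; rewrite tangentM ?tangent_cst ?mulr0 ?addr0//.
exact: smoothf_on_cst.
Qed.

Lemma tangentN f : smoothf f -> u (fun y => - f y) = - u f.
Proof.
move=> sf; rewrite -[RHS]mulN1r -tangentZ//; congr u.
by apply/funext => y; rewrite mulN1r.
Qed.

Lemma tangentB f h : smoothf f -> smoothf h -> u (fun y => f y - h y) = u f - u h.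
Proof.
by move=> sf sh; rewrite tangentD ?tangentN//; exact: smoothf_on_opp openT sh.
Qed.

Lemma tangent_sum (I : Type) (r : seq I) (F : I -> M -> R) :
  (forall i, smoothf (F i)) ->
  u (fun y => \sum_(i <- r) F i y) = \sum_(i <- r) u (F i).
Proof.
move=> sF; elim: r => [|i r IH].
  rewrite big_nil -[RHS](tangent_cst 0); congr u.
  by apply/funext => y; rewrite big_nil.
rewrite big_cons -IH -tangentD//; last exact: smoothf_on_sum openT _.
by congr u; apply/funext => y; rewrite big_cons.
Qed.

End Tangent.

End SmoothFunctions.

(** * Smooth matrix-valued functions *)

Section SmoothMatrices.
Variables (R : realType) (M : manifold R).
Implicit Type U : set M.

Definition smooth_mx (p q : nat) U (F : M -> 'M[R]_(p, q)) : Prop :=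
  forall i j, smoothf_on U (fun x => F x i j).

Lemma smooth_mx_subset p q U U' (F : M -> 'M[R]_(p, q)) :
  U' `<=` U -> smooth_mx U F -> smooth_mx U' F.
Proof. by move=> sU H i j; exact: smoothf_on_subset sU (H i j). Qed.

Lemma smooth_mx_cst p q U (A : 'M[R]_(p, q)) : smooth_mx U (fun=> A).
Proof. by move=> i j; exact: smoothf_on_cst. Qed.

Lemma smooth_mxB p q U (F H : M -> 'M[R]_(p, q)) : open U ->
  smooth_mx U F -> smooth_mx U H -> smooth_mx U (fun x => F x - H x).
Proof.
move=> oU sF sH i j.
rewrite (_ : (fun x => _) = fun x => F x i j + - H x i j); last first.
  by apply/funext => x; rewrite !mxE.
by apply: smoothf_on_add => //; exact: smoothf_on_opp.
Qed.

Lemma smooth_mxD p q U (F H : M -> 'M[R]_(p, q)) : open U ->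
  smooth_mx U F -> smooth_mx U H -> smooth_mx U (fun x => F x + H x).
Proof.
move=> oU sF sH i j.
rewrite (_ : (fun x => _) = fun x => F x i j + H x i j); last first.
  by apply/funext => x; rewrite !mxE.
exact: smoothf_on_add.
Qed.

Lemma smooth_mxM p q r U (F : M -> 'M[R]_(p, q)) (H : M -> 'M[R]_(q, r)) :
  open U -> smooth_mx U F -> smooth_mx U H -> smooth_mx U (fun x => F x *m H x).
Proof.
move=> oU sF sH i j.
rewrite (_ : (fun x => _) = fun x => \sum_k F x i k * H x k j); last first.
  by apply/funext => x; rewrite !mxE.
by apply: smoothf_on_sum => // k; exact: smoothf_on_mul.
Qed.

Lemma smoothf_on_det p U (F : M -> 'M[R]_p) : open U -> smooth_mx U F ->
  smoothf_on U (fun x => \det (F x)).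
Proof.
move=> oU sF; apply: smoothf_on_sum => // s.
apply: smoothf_on_mul => //; first exact: smoothf_on_cst.
by apply: smoothf_on_prod => // i; exact: sF.
Qed.

(** Cramer's rule: the entries are cofactors divided by the determinant. *)
Lemma smooth_mx_inv p U (F : M -> 'M[R]_p) : open U -> smooth_mx U F ->
  (forall x, U x -> F x \in unitmx) -> smooth_mx U (fun x => invmx (F x)).
Proof.
move=> oU sF uF i j.
apply: (@smoothf_on_eq _ _ _ (fun x => (\det (F x))^-1 *
    ((-1) ^+ (j + i) * \det (row' j (col' i (F x)))))) => //.
  by move=> x /uF ux; rewrite /invmx ux !mxE.
apply: smoothf_on_mul => //.
  apply: smoothf_on_inv => //; last exact: smoothf_on_det.
  by move=> x /uF; rewrite unitmxE unitfE.
apply: smoothf_on_mul => //; first exact: smoothf_on_cst.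
apply: smoothf_on_det => // a b.
rewrite (_ : (fun x => _) = fun x => F x (lift j a) (lift i b)); first exact: sF.
by apply/funext => x; rewrite !mxE.
Qed.

Lemma open_unitmx p U (F : M -> 'M[R]_p) x : open U -> U x -> smooth_mx U F ->
  F x \in unitmx ->
  exists V : set M, [/\ open V, V x, V `<=` U & forall y, V y -> F y \in unitmx].
Proof.
move=> oU Ux sF; rewrite unitmxE unitfE.
move=> /(open_neq0 oU Ux (smoothf_on_det oU sF))[V [oV Vx VU H]].
by exists V; split=> // y /H; rewrite unitmxE unitfE.
Qed.

(** The pseudo-inverse is frozen at x, so it is constant in y. Its product with H y is the identity
    at x, hence invertible nearby, and only this square matrix is inverted smoothly. *)
Lemma smooth_right_inverse p q U (H : M -> 'M[R]_(p, q)) x :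
  open U -> U x -> smooth_mx U H -> row_free (H x) ->
  exists (V : set M) (J : M -> 'M[R]_(q, p)),
    [/\ open V, V x, V `<=` U, smooth_mx V J & forall y, V y -> H y *m J y = 1%:M].
Proof.
move=> oU Ux sH fH; pose F y := H y *m pinvmx (H x).
have sF : smooth_mx U F by apply: smooth_mxM => //; exact: smooth_mx_cst.
have uF : F x \in unitmx by rewrite /F mulmxVp// unitmx1.
have [V [oV Vx VU uV]] := open_unitmx oU Ux sF uF.
exists V, (fun y => pinvmx (H x) *m invmx (F y)); split=> //.
  apply: smooth_mxM => //; first exact: smooth_mx_cst.
  by apply: smooth_mx_inv => //; exact: smooth_mx_subset sF.
by move=> y /uV uy; rewrite mulmxA mulmxV.
Qed.

(* With [C = 1 - P x0 *m pinvmx (P x0)], the matrix [F = P *m pinvmx (P x0) + C]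
   is the identity at x0, and w *m P y = 0 gives w *m F y = w *m C; so the
   kernel of [P y] lies in, hence by rank equals, the row space of C *m (F y)^-1. *)
Lemma smooth_kernel_frame p q d U (P : M -> 'M[R]_(p, q)) x :
  open U -> U x -> smooth_mx U P -> (forall y, U y -> \rank (kermx (P y)) = d) ->
  exists (V : set M) (B : M -> 'M[R]_(d, p)),
    [/\ open V, V x, V `<=` U, smooth_mx V B &
        forall y, V y -> row_free (B y) /\ (B y :=: kermx (P y))%MS].
Proof.
move=> oU Ux sP rP; pose C := 1%:M - P x *m pinvmx (P x).
have CP : C *m P x = 0 by rewrite mulmxBl mul1mx mulmxKpV ?subrr.
have rC : \rank C = d.
  rewrite -(rP _ Ux); apply/eqP; rewrite eqn_leq.
  rewrite mxrankS ?sub_kermx ?CP//= mxrankS//.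
  apply/submxP; exists (kermx (P x)).
  by rewrite mulmxBr mulmx1 mulmxA mulmx_ker mul0mx subr0.
pose F y := P y *m pinvmx (P x) + C.
have sF : smooth_mx U F.
  apply: smooth_mxD => //; last exact: smooth_mx_cst.
  by apply: smooth_mxM => //; exact: smooth_mx_cst.
have uF : F x \in unitmx by rewrite /F /C addrC subrK unitmx1.
have [V [oV Vx VU uV]] := open_unitmx oU Ux sF uF.
have [B0 B0C] : exists B0 : 'M[R]_(d, p), (B0 :=: C)%MS.
  by rewrite -rC; exists (row_base C); exact: eq_row_base.
exists V, (fun y => B0 *m invmx (F y)); split=> //.
  apply: smooth_mxM => //; first exact: smooth_mx_cst.
  by apply: smooth_mx_inv => //; exact: smooth_mx_subset sF.
move=> y Vy.
have kB : (kermx (P y) <= B0 *m invmx (F y))%MS.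
  have -> : kermx (P y) = kermx (P y) *m C *m invmx (F y).
    apply: (canRL (mulmxK (uV _ Vy))).
    by rewrite mulmxDr mulmxA mulmx_ker mul0mx add0r.
  by apply: submxMr; rewrite B0C submxMl.
have rB : \rank (B0 *m invmx (F y)) = d.
  apply/eqP; rewrite eqn_leq rank_leq_row /= -{1}(rP _ (VU _ Vy)).
  exact: mxrankS.
split; first by rewrite /row_free rB.
apply/eqmxP; rewrite andbC kB /=.
by rewrite -(geq_leqif (mxrank_leqif_sup kB)) rB rP//; exact: VU.
Qed.

End SmoothMatrices.

(** * Sections of a trivial bundle *)

Section VectorValued.
Variables (R : realType) (S : manifold R) (E : vectType R).
Implicit Types (U : set S) (s t : S -> E) (f : S -> R).

Local Notation b := (vbasis {:E}).
Local Notation cf := (coord b).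

Lemma coord_inj (v w : E) : (forall i, cf i v = cf i w) -> v = w.
Proof.
by move=> H; rewrite (coord_vbasis (memvf v)) (coord_vbasis (memvf w));
  apply: eq_bigr => i _; rewrite H.
Qed.

Definition smoothv_on U s : Prop := forall i, smoothf_on U (fun y => cf i (s y)).

Lemma smooth_sect_on_trivial U (s : sect (trivial_bundle S E)) :
  smooth_sect_on U s <-> smoothv_on U s.
Proof.
split=> [H i | H e -> i].
  by have := H _ erefl i; rewrite /= setIT.
by rewrite /= setIT; exact: H.
Qed.

Lemma smoothv_on_subset U U' s : U' `<=` U -> smoothv_on U s -> smoothv_on U' s.
Proof. by move=> sU H i; exact: smoothf_on_subset sU (H i). Qed.

Lemma smoothv_on_local U s :
  (forall x, U x -> exists2 U' : set S, U' x & smoothv_on U' s) -> smoothv_on U s.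
Proof.
by move=> H i; apply: smoothf_on_local => x /H[U' U'x sU]; exists U'.
Qed.

Lemma smoothv_on_eq U s t : open U -> (forall x, U x -> s x = t x) ->
  smoothv_on U s -> smoothv_on U t.
Proof.
by move=> oU st H i; apply: smoothf_on_eq (H i) => // x Ux; rewrite st.
Qed.

Lemma smoothv_on_cst U (v : E) : smoothv_on U (fun=> v).
Proof. by move=> i; exact: smoothf_on_cst. Qed.

Lemma smoothv_onD U s t : open U -> smoothv_on U s -> smoothv_on U t ->
  smoothv_on U (fun x => s x + t x).
Proof.
move=> oU Hs Ht i; under eq_fun do rewrite linearD /=.
exact: smoothf_on_add (Hs i) (Ht i).
Qed.

Lemma smoothv_onZ U f s : open U -> smoothf_on U f -> smoothv_on U s ->
  smoothv_on U (fun x => f x *: s x).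
Proof.
move=> oU Hs Ht i; under eq_fun do rewrite linearZ /=.
exact: smoothf_on_mul Hs (Ht i).
Qed.

Lemma smoothv_onB U s t : open U -> smoothv_on U s -> smoothv_on U t ->
  smoothv_on U (fun x => s x - t x).
Proof.
move=> oU Hs Ht i; under eq_fun do rewrite linearB /=.
exact: smoothf_on_add (Hs i) (smoothf_on_opp _ (Ht i)).
Qed.

Lemma smoothv_on_sum U (I : Type) (r : seq I) (F : I -> S -> E) :
  open U -> (forall i, smoothv_on U (F i)) ->
  smoothv_on U (fun x => \sum_(i <- r) F i x).
Proof.
move=> oU HF i; under eq_fun do rewrite linear_sum /=.
by apply: smoothf_on_sum => // j; exact: HF.
Qed.

Definition coord_mx k (e : 'I_k -> E) : 'M[R]_(k, \dim {:E}) :=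
  \matrix_(i, j) cf j (e i).

Definition coord_row (v : E) : 'rV[R]_(\dim {:E}) := \row_j cf j v.

Lemma coord_row_inj : injective coord_row.
Proof.
by move=> v w /rowP H; apply: coord_inj => i; have := H i; rewrite !mxE.
Qed.

Lemma coord_row_comb k (e : 'I_k -> E) (w : 'rV[R]_k) :
  coord_row (\sum_i w ord0 i *: e i) = w *m coord_mx e.
Proof.
apply/rowP => j; rewrite !mxE linear_sum; apply: eq_bigr => i _.
by rewrite linearZ mxE.
Qed.

Lemma row_free_coord_mx k (e : 'I_k -> E) :
  (forall c : 'I_k -> R, \sum_i c i *: e i = 0 -> forall i, c i = 0) ->
  row_free (coord_mx e).
Proof.
move=> He; rewrite -kermx_eq0; apply/rowV0P => w /sub_kermxP wH.
have : \sum_i w ord0 i *: e i = 0.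
  by apply: coord_row_inj; rewrite coord_row_comb wH; apply/rowP => j;
    rewrite !mxE linear0.
by move=> /He w0; apply/rowP => i; rewrite mxE w0.
Qed.

(** The coefficients come from pointwise choices. Multiplying the coordinates of s by a smooth right
    inverse of the coordinate matrix of e recovers them, and this expression is smooth. *)
Lemma smoothf_on_coefficients k U (e : 'I_k -> S -> E) (c : 'I_k -> S -> R) s :
  open U -> (forall i, smoothv_on U (e i)) -> smoothv_on U s ->
  (forall x, U x -> forall a : 'I_k -> R, \sum_i a i *: e i x = 0 -> forall i, a i =
    0) ->
  (forall x, U x -> s x = \sum_i c i x *: e i x) ->
  forall i, smoothf_on U (c i).
Proof.
move=> oU se ss fe sE i; apply: smoothf_on_local => x Ux.
pose H y := coord_mx (fun i => e i y).
have sH : smooth_mx U H.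
  move=> p q; rewrite /H /coord_mx; under eq_fun do rewrite mxE.
exact: se.
have [V [J [oV Vx VU sJ HJ]]] := smooth_right_inverse oU Ux sH (row_free_coord_mx (fe
  _ Ux)).
exists V => //.
apply: (@smoothf_on_eq _ _ _ (fun y => (coord_row (s y) *m J y) ord0 i)) => //.
  move=> y Vy; rewrite sE; last exact: VU.
  rewrite (_ : \sum_i c i y *: e i y =
    \sum_i (\row_i c i y) ord0 i *: e i y).
    by rewrite coord_row_comb -mulmxA HJ// mulmx1 mxE.
  by apply: eq_bigr => j _; rewrite mxE.
apply: smooth_mxM => // p q; rewrite /coord_row; under eq_fun do rewrite mxE.
exact: smoothf_on_subset VU (ss q).
Qed.

Section Flat.
Variables (x : S) (u : (S -> R) -> R) (tu : is_tangent x u).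

Lemma coord_flat s i : cf i (flat u s) = u (fun y => cf i (s y)).
Proof.
rewrite /flat.
rewrite (_ : (\sum_j _) = \sum_j u (fun y => cf j (s y)) *: b`_j).
  by rewrite coord_sum_free// (basis_free (vbasisP _)).
by apply: eq_bigr => j _; rewrite (tnth_nth 0).
Qed.

Lemma flatD s t : smoothv_on setT s -> smoothv_on setT t ->
  flat u (fun y => s y + t y) = flat u s + flat u t.
Proof.
move=> ss st; apply: coord_inj => i; rewrite linearD /= !coord_flat.
under eq_fun do rewrite linearD /=.
exact: (tangentD tu (ss i) (st i)).
Qed.

Lemma flatB s t : smoothv_on setT s -> smoothv_on setT t ->
  flat u (fun y => s y - t y) = flat u s - flat u t.
Proof.
move=> ss st; apply: coord_inj => i; rewrite linearB /= !coord_flat.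
under eq_fun do rewrite linearB /=.
exact: (tangentB tu (ss i) (st i)).
Qed.

Lemma flatZ f s : smoothf f -> smoothv_on setT s ->
  flat u (fun y => f y *: s y) = f x *: flat u s + u f *: s x.
Proof.
move=> sf ss; apply: coord_inj => i; rewrite linearD !linearZ /= !coord_flat.
under eq_fun do rewrite linearZ /=.
rewrite (tangentM tu sf (ss i)).
by rewrite [u f * _]mulrC.
Qed.

Lemma flat_cst (v : E) : flat u (fun=> v) = 0.
Proof. by apply: coord_inj => i; rewrite coord_flat (tangent_cst tu) linear0. Qed.

Lemma flat_sum (I : Type) (r : seq I) (F : I -> S -> E) :
  (forall i, smoothv_on setT (F i)) ->
  flat u (fun y => \sum_(i <- r) F i y) = \sum_(i <- r) flat u (F i).
Proof.
move=> sF; apply: coord_inj => i; rewrite coord_flat [RHS]linear_sum /=.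
under eq_fun do rewrite linear_sum /=.
rewrite (tangent_sum tu) => [|j]; last exact: sF.
by apply: eq_bigr => j _; rewrite coord_flat.
Qed.

(** Transitivity presents a tangent vector as an anchor only up to agreement on smooth functions;
    this makes the two interchangeable in [flat]. *)
Lemma eq_flat (u' : (S -> R) -> R) s : smoothv_on setT s ->
  (forall f, smoothf f -> u f = u' f) -> flat u s = flat u' s.
Proof. by move=> ss uu; apply: eq_bigr => i _; rewrite uu//; exact: ss. Qed.

End Flat.

Section Bilinear.
Variable B : E -> E -> E.
Hypothesis Bl : forall (a : R) v w z, B (a *: v + w) z = a *: B v z + B w z.
Hypothesis Br : forall (a : R) v w z, B z (a *: v + w) = a *: B z v + B z w.

Let Bl0 z : B 0 z = 0.
Proof. by have := Bl (-1) 0 0 z; rewrite scaler0 addr0 scaleN1r addNr. Qed.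

Let Br0 z : B z 0 = 0.
Proof. by have := Br (-1) 0 0 z; rewrite scaler0 addr0 scaleN1r addNr. Qed.

Lemma bilinear_coord v w :
  B v w = \sum_i \sum_j (cf i v * cf j w) *: B (b`_i) (b`_j).
Proof.
have Bsl z (r : seq 'I_(\dim {:E})) : B (\sum_(i <- r) cf i v *: b`_i) z
    = \sum_(i <- r) cf i v *: B (b`_i) z.
  by elim: r => [|i r IH]; rewrite ?big_nil ?Bl0// !big_cons Bl IH.
have Bsr z (r : seq 'I_(\dim {:E})) : B z (\sum_(i <- r) cf i w *: b`_i)
    = \sum_(i <- r) cf i w *: B z (b`_i).
  by elim: r => [|i r IH]; rewrite ?big_nil ?Br0// !big_cons Br IH.
rewrite {1}(coord_vbasis (memvf v)) {1}(coord_vbasis (memvf w)) Bsl.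
apply: eq_bigr => i _; rewrite Bsr scaler_sumr; apply: eq_bigr => j _.
by rewrite scalerA.
Qed.

Lemma smoothv_on_bilinear U s t : open U -> smoothv_on U s -> smoothv_on U t ->
  smoothv_on U (fun y => B (s y) (t y)).
Proof.
move=> oU ss st; rewrite (_ : (fun y => _) = fun y => \sum_i \sum_j
    (cf i (s y) * cf j (t y)) *: B (b`_i) (b`_j)).
  apply: smoothv_on_sum => // i; apply: smoothv_on_sum => // j.
  apply: smoothv_onZ => //; last exact: smoothv_on_cst.
  exact: smoothf_on_mul.
by apply/funext => y; exact: bilinear_coord.
Qed.

(** The values of B on the fixed basis are constants, so only products of coordinate functions are
    differentiated. *)
Lemma flat_bilinear x u s t : is_tangent x u ->
  smoothv_on setT s -> smoothv_on setT t ->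
  flat u (fun y => B (s y) (t y)) = B (flat u s) (t x) + B (s x) (flat u t).
Proof.
move=> tu ss st; have oT := @openT S.
have sst i j : smoothf (fun y => cf i (s y) * cf j (t y)).
  exact: smoothf_on_mul.
rewrite (_ : (fun y => _) = fun y => \sum_i \sum_j
    (cf i (s y) * cf j (t y)) *: B (b`_i) (b`_j)); last first.
  by apply/funext => y; exact: bilinear_coord.
have sS i j : smoothv_on setT (fun y => (cf i (s y) * cf j (t y)) *: B (b`_i) (b`_j)).
  by apply: smoothv_onZ => //; [exact: sst | exact: smoothv_on_cst].
rewrite (flat_sum tu) => [|i]; last by exact: smoothv_on_sum.
rewrite !bilinear_coord -big_split /=; apply: eq_bigr => i _.
rewrite (flat_sum tu)// -big_split /=; apply: eq_bigr => j _.
rewrite (flatZ tu (sst i j)); last exact: smoothv_on_cst.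
rewrite (flat_cst tu) scaler0 add0r (tangentM tu (ss i) (st j)) !coord_flat.
by rewrite -scalerDl addrC; congr (_ *: _); congr (_ + _); exact: mulrC.
Qed.

End Bilinear.

End VectorValued.

(** * Subbundles and the filtration step *)

(** The family e identifies coefficient rows with vectors injectively, and under it the row space of
    B corresponds to H; a basis of the one is carried to a basis of the other. *)
Lemma frame_of_matrix (R : realType) (V : vectType R) (H : {vspace V}) k d
    (e : 'I_k -> V) (B : 'M[R]_(d, k)) :
  (forall a : 'I_k -> R, \sum_i a i *: e i = 0 -> forall i, a i = 0) ->
  (forall v, v \in H -> exists w : 'rV[R]_k, v = \sum_i w ord0 i *: e i) ->
  row_free B ->
  (forall w : 'rV[R]_k, (w <= B)%MS <-> \sum_i w ord0 i *: e i \in H) ->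
  basis_of H [tuple \sum_i B a i *: e i | a < d].
Proof.
move=> fe He fB HB.
have comb (c : 'rV[R]_d) :
    \sum_a c ord0 a *: \sum_i B a i *: e i = \sum_i (c *m B) ord0 i *: e i.
  under eq_bigr do rewrite scaler_sumr.
  rewrite exchange_big /=; apply: eq_bigr => i _; rewrite mxE scaler_suml.
  by apply: eq_bigr => a _; rewrite scalerA.
have fT : free [tuple \sum_i B a i *: e i | a < d].
  apply/freeP => c c0 a.
  have : \sum_a (\row_a c a) ord0 a *: (\sum_i B a i *: e i) = 0.
    rewrite -[RHS]c0; apply: eq_bigr => a' _.
    by rewrite mxE -tnth_nth tnth_mktuple.
  rewrite comb => /fe cB.
  have : \row_a c a *m B = 0 by apply/rowP => i; rewrite cB mxE.
  move/eqP; rewrite mulmx_free_eq0// => /eqP/rowP/(_ a).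
  by rewrite !mxE.
rewrite /basis_of fT andbT eqEsubv; apply/andP; split.
  apply/span_subvP => _ /tnthP[a ->]; rewrite tnth_mktuple.
  have /HB := row_sub a B.
  by under eq_bigr do rewrite mxE.
apply/subvP => v vH; have [w vw] := He v vH.
move: (vH); rewrite vw => /HB/submxP[c ->]; rewrite -comb.
apply: memv_suml => a _; apply: memvZ.
apply: memv_span; apply/tnthP; exists a; rewrite tnth_mktuple//.
Qed.

(** * Sections of A as g-valued functions, global frames, and the second fundamental form *)

Section Immersion.
Variables (R : realType) (G : lie_group R) (g : lie_algebra G) (S : manifold R).
Variables (A : lie_algebroid S) (omega : forall x, 'Hom(A x, g)).
Hypothesis omega_smooth : forall e (i : 'I_(rank A)), frames e ->
  @smooth_sect_on _ _ (trivial_bundle S g) (fdom e)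
    (fun x => omega x (tnth (fr e x) i)).
Hypothesis omega_inj : forall x, injective (omega x).

Let oT := @openT S.

Definition push (X : sect A) : S -> g := fun x => omega x (X x).

Lemma frame_free e x : @frames _ _ A e -> fdom e x ->
  forall a : 'I_(rank A) -> R, \sum_i a i *: tnth (fr e x) i = 0 -> forall i, a i = 0.
Proof.
move=> Fe ex a a0; have /basis_free/freeP := vb_basis Fe ex; apply.
by rewrite -[RHS]a0; apply: eq_bigr => i _; rewrite (tnth_nth 0).
Qed.

Lemma frame_coord e x (v : A x) : @frames _ _ A e -> fdom e x ->
  v = \sum_i coord (fr e x) i v *: tnth (fr e x) i.
Proof.
move=> Fe ex; rewrite {1}(coord_basis (vb_basis Fe ex) (memvf v)).
by apply: eq_bigr => i _; rewrite (tnth_nth 0).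
Qed.

Lemma omega_comb x k (c : 'I_k -> R) (e : 'I_k -> A x) :
  omega x (\sum_i c i *: e i) = \sum_i c i *: omega x (e i).
Proof. by rewrite linear_sum; apply: eq_bigr => i _; rewrite linearZ. Qed.

(** The converse direction rests on injectivity: the images of a local frame stay independent, so
    [smoothf_on_coefficients] returns the frame coefficients of X. *)
Lemma smooth_push U (X : sect A) : open U ->
  smooth_sect_on U X <-> smoothv_on U (push X).
Proof.
move=> oU; split=> sX.
  apply: smoothv_on_local => x Ux; have [e Fe ex] := vb_cover A x.
  have oe := vb_open Fe; have oUe := openI oU oe.
  exists (U `&` fdom e) => //.
  apply: (@smoothv_on_eq _ _ _ _ (fun y => \sum_i coord (fr e y) i (X y) *:
      omega y (tnth (fr e y) i))) => //.
    by move=> y [_ ey]; rewrite /push {2}(frame_coord (X y) Fe ey) omega_comb.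
  apply: smoothv_on_sum => // i; apply: smoothv_onZ => //; first exact: sX.
  apply: (@smoothv_on_subset _ _ _ (fdom e)); first by move=> y [].
  exact/smooth_sect_on_trivial/omega_smooth.
move=> e Fe; have oe := vb_open Fe.
apply: (@smoothf_on_coefficients _ _ _ _ (U `&` fdom e)
  (fun i y => omega y (tnth (fr e y) i)) _ (push X)).
- exact: openI.
- move=> i; apply: (@smoothv_on_subset _ _ _ (fdom e)); first by move=> y [].
  exact/smooth_sect_on_trivial/omega_smooth.
- by apply: smoothv_on_subset sX => y [].
- move=> y [_ ey] a; rewrite -omega_comb -[RHS](linear0 (omega y)) => /omega_inj.
  exact: frame_free.
- by move=> y [_ ey]; rewrite /push {1}(frame_coord (X y) Fe ey) omega_comb.
Qed.

Lemma smooth_sect_push (X : sect A) : smooth_sect X <-> smoothv_on setT (push X).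
Proof. exact: smooth_push. Qed.

Lemma smooth_sectD (X Y : sect A) : smooth_sect X -> smooth_sect Y ->
  smooth_sect (fun x => X x + Y x).
Proof.
move=> /smooth_sect_push sX /smooth_sect_push sY; apply/smooth_sect_push.
rewrite /push; under eq_fun do rewrite linearD /=; exact: smoothv_onD.
Qed.

Lemma smooth_sectZ f (X : sect A) : smoothf f -> smooth_sect X ->
  smooth_sect (fun x => f x *: X x).
Proof.
move=> sf /smooth_sect_push sX; apply/smooth_sect_push.
rewrite /push; under eq_fun do rewrite linearZ /=; exact: smoothv_onZ.
Qed.

Lemma smooth_sect_comb k (c : 'I_k -> R) (e : 'I_k -> sect A) :
  (forall i, smooth_sect (e i)) -> smooth_sect (fun x => \sum_i c i *: e i x).
Proof.
move=> se; apply/smooth_sect_push; rewrite /push.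
under eq_fun do rewrite omega_comb; apply: smoothv_on_sum => // i.
apply: smoothv_onZ => //; first exact: smoothf_on_cst.
exact/smooth_sect_push.
Qed.

Lemma push_comb k (c : 'I_k -> R) (e : 'I_k -> sect A) :
  push (fun x => \sum_i c i *: e i x) = fun x => \sum_i c i *: push (e i) x.
Proof. by apply/funext => x; rewrite /push omega_comb. Qed.

Lemma smooth_anchor (X : sect A) f : smooth_sect X -> smoothf f ->
  smoothf (fun x => anchor (X x) f).
Proof.
move=> sX sf; apply: smoothf_on_local => x _; have [e Fe ex] := vb_cover A x.
have oe := vb_open Fe; exists (fdom e) => //.
have an0 y : anchor (0 : A y) f = 0.
  by have := anchor_linear (-1) (0 : A y) 0 sf; rewrite scaler0 addr0 mulN1r addNr.
apply: (@smoothf_on_eq _ _ _ (fun y => \sum_i coord (fr e y) i (X y) *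
    anchor (tnth (fr e y) i) f)) => //.
  move=> y ey; rewrite [in RHS](frame_coord (X y) Fe ey).
  elim: (index_enum _) => [|i r IH]; first by rewrite !big_nil an0.
  by rewrite !big_cons anchor_linear// IH.
apply: smoothf_on_sum => // i; apply: smoothf_on_mul => //.
  by have := sX e Fe i; rewrite setTI.
exact: anchor_smooth.
Qed.

Lemma smooth_flat_anchor (X : sect A) (s : S -> g) : smooth_sect X ->
  smoothv_on setT s -> smoothv_on setT (fun x => flat (anchor (X x)) s).
Proof.
move=> sX ss i; under eq_fun do rewrite coord_flat.
by apply: smooth_anchor => //; exact: ss.
Qed.

Lemma flat_anchor_linear x (c : R) (a b : A x) (s : S -> g) : smoothv_on setT s ->
  flat (anchor (c *: a + b)) s = c *: flat (anchor a) s + flat (anchor b) s.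
Proof.
move=> ss; apply: coord_inj => i; rewrite linearD linearZ /= !coord_flat.
by rewrite anchor_linear//; exact: ss.
Qed.

Lemma flat_anchor_comb x k (c : 'I_k -> R) (e : 'I_k -> A x) (s : S -> g) :
  smoothv_on setT s ->
  flat (anchor (\sum_i c i *: e i)) s = \sum_i c i *: flat (anchor (e i)) s.
Proof.
move=> ss; elim: (index_enum _) => [|i r IH]; last first.
  by rewrite !big_cons flat_anchor_linear// IH.
rewrite !big_nil; have := flat_anchor_linear (-1) (0 : A x) 0 ss.
by rewrite scaler0 addr0 scaleN1r addNr.
Qed.

Lemma subbundle0 (W : subfamily A) x : is_subbundle W -> W x 0.
Proof.
by move=> [k /(_ x)[U [e [_ Ux _ /(_ x Ux)[_ ->]]]]]; rewrite /= mem0v.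
Qed.

Lemma subbundle_linear (W : subfamily A) x (a : R) v w : is_subbundle W ->
  W x v -> W x w -> W x (a *: v + w).
Proof.
move=> [k /(_ x)[U [e [_ Ux _ /(_ x Ux)[_ ->]]]]] /= vW wW.
by rewrite memvD// memvZ.
Qed.

Lemma subbundle_comb (W : subfamily A) x k (c : 'I_k -> R) (e : 'I_k -> A x) :
  is_subbundle W -> (forall i, W x (e i)) -> W x (\sum_i c i *: e i).
Proof.
move=> sW We; elim: (index_enum _) => [|i r IH]; first by rewrite big_nil;
  exact: subbundle0.
by rewrite big_cons; exact: subbundle_linear.
Qed.

Lemma omega_image_linear (W : subfamily A) x (a : R) v w : is_subbundle W ->
  omega_image omega W x v -> omega_image omega W x w ->
  omega_image omega W x (a *: v + w).
Proof.
move=> sW [v' Wv <-] [w' Ww <-]; exists (a *: v' + w'); last by rewrite linearP.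
exact: subbundle_linear.
Qed.

Lemma omega_image_comb (W : subfamily A) x k (c : 'I_k -> R) (v : 'I_k -> g) :
  is_subbundle W -> (forall i, omega_image omega W x (v i)) ->
  omega_image omega W x (\sum_i c i *: v i).
Proof.
move=> sW Wv; elim: (index_enum _) => [|i r IH].
  by rewrite big_nil; exists 0; [exact: subbundle0 | rewrite linear0].
by rewrite big_cons; exact: omega_image_linear.
Qed.

(** The sections are global, so that they qualify for [sect_in], but they form a basis over U only;
    elsewhere they may vanish. *)
Definition is_global_frame k (W : subfamily A) (U : set S) (e : 'I_k -> sect A) :
  Prop :=
  (forall i, sect_in W (e i)) /\
  forall y, U y ->
    (forall a : 'I_k -> R, \sum_i a i *: e i y = 0 -> forall i, a i = 0) /\
    (forall v, W y v -> exists a : 'I_k -> R, v = \sum_i a i *: e i y).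

(** A local frame is multiplied by a bump function: it remains a basis where the bump is nonzero,
    and off the support its zero values still lie in W. *)
Lemma global_frame (W : subfamily A) x : is_subbundle W ->
  exists k U (e : 'I_k -> sect A), [/\ open U, U x & is_global_frame W U e].
Proof.
move=> sW; have [k /(_ x)[U [e [oU Ux se eW]]]] := sW.
have [phi [K [sphi phi1 cK KU phi0]]] := bump_function oU Ux.
have phix : phi x != 0 by rewrite phi1 oner_neq0.
have [V [oV Vx VU Vphi]] := open_neq0 oU Ux (@smoothf_onW _ _ U _ sphi) phix.
exists k, V, (fun i y => phi y *: tnth (e y) i); split=> //; split=> [i|y Vy].
  split.
    apply/smooth_sect_push.
    rewrite /push; under eq_fun do rewrite linearZ /=.
    have /(smooth_push _ oU) sei := se i.
    by move=> j; under eq_fun do rewrite linearZ /=;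
      exact: (smoothf_bump_mul oU cK KU sphi phi0 (sei j)).
  move=> y; have [Ky|nKy] := pselect (K y); last first.
    by rewrite phi0// scale0r; exact: subbundle0.
  have [_ ->] := eW y (KU _ Ky); rewrite /=; apply: memvZ; apply: memv_span.
  exact: mem_tnth.
have [/freeP fy ->] := eW y (VU _ Vy); split.
  move=> a a0 i; have : a i * phi y = 0.
    apply: (fy (fun i => a i * phi y)).
    by rewrite -[RHS]a0; apply: eq_bigr => j _; rewrite (tnth_nth 0) scalerA.
  by move/eqP; rewrite mulf_eq0 (negbTE (Vphi _ Vy)) orbF => /eqP.
move=> v /= /coord_span vE; exists (fun i => coord (e y) i v * (phi y)^-1).
rewrite {1}vE; apply: eq_bigr => i _.
by rewrite scalerA mulfVK ?Vphi// (tnth_nth 0).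
Qed.

Lemma sect_in_comb (W : subfamily A) k (c : 'I_k -> R) (e : 'I_k -> sect A) :
  is_subbundle W -> (forall i, sect_in W (e i)) ->
  sect_in W (fun x => \sum_i c i *: e i x).
Proof.
move=> sW We; split; first by apply: smooth_sect_comb => i; have [] := We i.
by move=> x; apply: subbundle_comb => // i; have [] := We i.
Qed.

Lemma subbundle_extension (W : subfamily A) x (v : A x) : is_subbundle W ->
  W x v -> exists2 X : sect A, sect_in W X & X x = v.
Proof.
move=> sW Wv; have [k [U [e [oU Ux [We /(_ x Ux)[_ /(_ v Wv)[a ->]]]]]]] :=
  global_frame x sW.
by exists (fun y => \sum_i a i *: e i y) => //; exact: sect_in_comb.
Qed.

(* If X vanishes at x then X = sum_i c_i e_i near x with c_i(x) = 0, so the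
   derivative of X at x is the combination sum_i u(c_i) e_i(x). *)
Lemma flat_vanishing (W : subfamily A) x u (X : sect A) : is_subbundle W ->
  is_tangent x u -> sect_in W X -> X x = 0 -> omega_image omega W x (flat u (push X)).
Proof.
move=> sW tu [sX WX] X0.
have [k [U [e [oU Ux [We fe]]]]] := global_frame x sW.
have [phi [K [sphi phi1 cK KU phi0]]] := bump_function oU Ux.
have /choice[c cE] y : exists a : 'I_k -> R, U y -> X y = \sum_i a i *: e i y.
  have [Uy|nUy] := pselect (U y); last by exists (fun=> 0).
  by have [_ /(_ _ (WX y))[a aE]] := fe y Uy; exists a.
have spX : smoothv_on setT (push X) by exact/smooth_sect_push.
have spe i : smoothv_on setT (push (e i)) by apply/smooth_sect_push; have [] := We i.
have sc i : smoothf_on U (fun y => c y i).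
  apply: (@smoothf_on_coefficients _ _ _ _ U (fun i => push (e i)) (fun i y => c y i)
    (push X)) => //.
  - by move=> j; exact: smoothv_on_subset (spe j).
  - exact: smoothv_on_subset spX.
  - move=> y Uy a; rewrite /push -omega_comb -[RHS](linear0 (omega y)) => /omega_inj.
    by have [H _] := fe y Uy; exact: H.
  - by move=> y Uy; rewrite /push {1}cE// omega_comb.
have spc i : smoothf (fun y => phi y * c y i) by exact: (smoothf_bump_mul oU cK KU
  sphi phi0 (sc i)).
have c0 i : c x i = 0.
  by have [H _] := fe x Ux; apply: H; rewrite -cE.
have E : (fun y => phi y *: push X y) = fun y => \sum_i (phi y * c y i) *: push (e i) y.
  apply/funext => y; have [Ky|nKy] := pselect (K y).
    rewrite {1}/push cE; last exact: KU.
    by rewrite omega_comb scaler_sumr; apply: eq_bigr => i _; rewrite scalerA.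
  by rewrite phi0// scale0r big1// => i _; rewrite mul0r scale0r.
(* The bump is known to equal 1 at x only, not near x; the extra term u(phi) X(x) disappears because
   X vanishes at x. *)
have -> : flat u (push X) = flat u (fun y => phi y *: push X y).
  by rewrite (flatZ tu)// phi1 scale1r /push X0 linear0 scaler0 addr0.
rewrite E (flat_sum tu) => [|i]; last by apply: smoothv_onZ;
  [exact: oT | exact: spc | exact: spe].
rewrite (_ : \sum_i _ = \sum_i u (fun y => phi y * c y i) *: push (e i) x).
  by apply: omega_image_comb => // i; exists (e i x) => //; have [] := We i.
by apply: eq_bigr => i _; rewrite (flatZ tu)// c0 mulr0 scale0r add0r.
Qed.

(** Replaces some extension of v by every extension: two of them differ by a section of W vanishing
    at x, whose derivatives lie in W by [flat_vanishing]. *)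
Lemma filtration_stepP (W : subfamily A) x v : is_subbundle W ->
  filtration_step omega W x v <->
  W x v /\ forall X, sect_in W X -> X x = v -> forall u, is_tangent x u ->
    omega_image omega W x (flat u (push X)).
Proof.
move=> sW; split; last first.
  move=> [Wv HX]; have [X WX Xv] := subbundle_extension sW Wv.
  by exists X; split=> //; exact: HX.
move=> [X [WX Xv HX]]; split; first by rewrite -Xv; have [] := WX.
move=> Y WY Yv u tu.
pose Z : sect A := fun y => (-1) *: X y + Y y.
have WZ : sect_in W Z.
  have [sX WXy] := WX; have [sY WYy] := WY; split.
    by apply: smooth_sectD => //; apply: smooth_sectZ => //; exact: smoothf_on_cst.
  by move=> y; exact: subbundle_linear.
have := flat_vanishing sW tu WZ; rewrite /Z Xv Yv scaleN1r addNr => /(_ erefl) HZ.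
have -> : flat u (push Y) = 1 *: flat u (push X) + flat u (push Z).
  rewrite scale1r -(flatD tu); first by congr flat; apply/funext => y;
    rewrite /push /Z linearD linearZ /= scaleN1r addrA subrr add0r.
  - by apply/smooth_sect_push; have [] := WX.
  - by apply/smooth_sect_push; have [] := WZ.
by apply: omega_image_linear => //; exact: HX.
Qed.

Lemma filtration_step_sub (W : subfamily A) x v : is_subbundle W ->
  filtration_step omega W x v -> W x v.
Proof. by move=> sW /(filtration_stepP _ sW)[]. Qed.

End Immersion.

Lemma flat_comb (R : realType) (S : manifold R) (E : vectType R) (x : S)
    (u : (S -> R) -> R) k (c : 'I_k -> R) (s : 'I_k -> S -> E) :
  is_tangent x u -> (forall i, smoothv_on setT (s i)) ->
  flat u (fun y => \sum_i c i *: s i y) = \sum_i c i *: flat u (s i).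
Proof.
move=> tu ss; have sc i : smoothf (fun _ : S => c i) by exact: smoothf_on_cst.
rewrite (flat_sum tu) => [|i]; last by apply: smoothv_onZ;
  [exact: openT | exact: sc | exact: ss].
by apply: eq_bigr => i _; rewrite (flatZ tu)// (tangent_cst tu) scale0r addr0.
Qed.

Lemma full_subbundle (R : realType) (S : manifold R) (V : vbundle S) :
  is_subbundle (fun x => [set: V x]).
Proof.
exists (rank V) => x; have [e Fe ex] := vb_cover V x.
exists (fdom e), (fr e); split=> //.
- exact: vb_open.
- by move=> i; exact: vb_compat.
- move=> y ey; have /andP[/eqP sp fr] := vb_basis Fe ey; split=> //.
  by apply/seteqP; split=> v //= _; rewrite sp memvf.
Qed.

(** * The next term of the filtration as a subbundle *)

Section FiltrationStep.
Variables (R : realType) (G : lie_group R) (g : lie_algebra G) (S : manifold R).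
Variables (A : lie_algebroid S) (omega : forall x, 'Hom(A x, g)).
Hypothesis omega_smooth : forall e (i : 'I_(rank A)), frames e ->
  @smooth_sect_on _ _ (trivial_bundle S g) (fdom e)
    (fun x => omega x (tnth (fr e x) i)).
Hypothesis omega_inj : forall x, injective (omega x).
Hypothesis A_transitive : is_transitive A.

Let oT := @openT S.
Local Notation N := (\dim {:g}).
Local Notation push := (push omega).

(* The fibre of the next term is the kernel of the second fundamental form
   W -> Hom(A, E / W), expressed below by the matrix P in local frames e of W
   and b of A; Pi is a smooth matrix whose row kernel is the image of W in E. *)
Lemma filtration_step_subbundle (W : subfamily A) : is_subbundle W ->
  constant_rank (filtration_step omega W) ->
  is_subbundle (filtration_step omega W).
Proof.
move=> sW [d Hd]; exists d => x.
have [k [U1 [e [oU1 U1x [We fe]]]]] := global_frame omega_smooth omega_inj x sW.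
have [m [U2 [b [oU2 U2x [Tb fb]]]]] :=
  global_frame omega_smooth omega_inj x (full_subbundle A).
have oU := openI oU1 oU2; set U := U1 `&` U2 in oU.
have Ux : U x by split.
have se i : smooth_sect (e i) by have [] := We i.
have spe i : smoothv_on setT (push (e i)) by exact/smooth_sect_push.
have sb l : smooth_sect (b l) by have [] := Tb l.
pose D l i y := flat (anchor (b l y)) (push (e i)).
have sD l i : smoothv_on setT (D l i) by exact: smooth_flat_anchor.
pose H y := coord_mx (fun i => push (e i) y).
have sH : smooth_mx U H.
  move=> i j; rewrite /H /coord_mx; under eq_fun do rewrite mxE.
  exact: smoothf_onW (spe i j).
have fpe y : U y -> forall a : 'I_k -> R,
    \sum_i a i *: push (e i) y = 0 -> forall i, a i = 0.
  move=> [U1y _] a; rewrite /push -omega_comb -[RHS](linear0 (omega y)) => /omega_inj.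
  by have [+ _] := fe y U1y; exact.
have [V [J [oV Vx VU sJ HJ]]] :=
  smooth_right_inverse oU Ux sH (row_free_coord_mx (fpe x Ux)).
(* Since H J = 1, the matrix J H projects onto the row space of H, which is W in coordinates; [Pi]
   is the complementary projection and stands for E -> E/W. *)
pose Pi y : 'M[R]_N := 1%:M - J y *m H y.
have sPi : smooth_mx V Pi.
  apply: smooth_mxB => //; first exact: smooth_mx_cst.
  by apply: smooth_mxM => //; exact: smooth_mx_subset sH.
have PiP y z : V y -> omega_image omega W y z <-> coord_row z *m Pi y = 0.
  move=> Vy; have [U1y _] := VU _ Vy; split.
    move=> [v Wv <-]; have [_ /(_ v Wv)[a ->]] := fe y U1y.
    rewrite omega_comb (_ : \sum_i _ = \sum_i (\row_i a i) ord0 i *: push (e i) y).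
      by rewrite coord_row_comb mulmxBr mulmx1 -mulmxA [H y *m _]mulmxA HJ// mul1mx
        subrr.
    by apply: eq_bigr => i _; rewrite mxE.
  rewrite mulmxBr mulmx1 mulmxA => /eqP; rewrite subr_eq0 => /eqP.
  rewrite -coord_row_comb => /coord_row_inj ->.
  by apply: omega_image_comb => // i; exists (e i y) => //; have [] := We i.
(* Row i holds the classes modulo W of the derivatives of e_i along all b_l, flattened by [mxvec],
   so that a Hom-valued form becomes an ordinary matrix with a row kernel. *)
pose P y : 'M[R]_(k, m * N) :=
  \matrix_i mxvec (\matrix_l (coord_row (D l i y) *m Pi y)).
have sP : smooth_mx V P.
  move=> i j; case/mxvec_indexP: j => l n.
  rewrite (_ : (fun y => _) = fun y => (coord_row (D l i y) *m Pi y) ord0 n).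
    apply: smooth_mxM => // p q; rewrite /coord_row; under eq_fun do rewrite mxE.
    exact: smoothf_onW (sD l i q).
  by apply/funext => y; rewrite mxE mxvecE mxE.
have wP y (w : 'rV[R]_k) : w *m P y =
    mxvec (\matrix_l (coord_row (\sum_i w ord0 i *: D l i y) *m Pi y)).
  apply/rowP => j; case/mxvec_indexP: j => l n.
  rewrite mxvecE [RHS]mxE coord_row_comb -mulmxA !mxE; apply: eq_bigr => i _.
  rewrite [in LHS]mxE mxvecE mxE; congr (_ * _).
  rewrite !mxE; apply: eq_bigr => q _; rewrite !mxE//.
have wP0 y (w : 'rV[R]_k) : V y -> w *m P y = 0 <->
    forall l, omega_image omega W y (\sum_i w ord0 i *: D l i y).
  move=> Vy; rewrite wP; split=> [H0 l|H0].
    apply/PiP => //; move/(canRL mxvecK): H0; rewrite linear0.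
    by move=> /row_matrixP/(_ l); rewrite rowK row0.
  rewrite (_ : (\matrix_l _) = 0) ?linear0//; apply/row_matrixP => l.
  by rewrite rowK row0; apply/PiP.
have FP y (w : 'rV[R]_k) : V y ->
    filtration_step omega W y (\sum_i w ord0 i *: e i y) <-> w *m P y = 0.
  move=> Vy; have [U1y U2y] := VU _ Vy.
  pose X : sect A := fun y => \sum_i w ord0 i *: e i y.
  have WX : sect_in W X by exact: (sect_in_comb omega_smooth omega_inj).
  have flatX u : is_tangent y u ->
      flat u (push X) = \sum_i w ord0 i *: flat u (push (e i)).
    by move=> tu; rewrite push_comb; apply: flat_comb tu _; exact: spe.
  rewrite wP0//; split.
    move=> /(filtration_stepP omega_smooth omega_inj _ sW)[_ HX] l.
    have tl := anchor_tangent (b l y).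
    by rewrite -(flatX _ tl); exact: HX.
  move=> HD; exists X; split=> // u tu; have [a _ au] := A_transitive tu.
  have [_ /(_ a I)[c ac]] := fb y U2y.
  have ssX : smoothv_on setT (push X) by apply/smooth_sect_push => //; have [] := WX.
  rewrite -(eq_flat ssX au) ac flat_anchor_comb//.
  apply: omega_image_comb => // l.
  by rewrite flatX; [exact: HD | exact: anchor_tangent].
have spanF y (K : {vspace A y}) : V y -> filtration_step omega W y = [set v | v \in
  K] ->
    forall v, v \in K -> exists w : 'rV[R]_k, v = \sum_i w ord0 i *: e i y.
  move=> Vy FK v vK; have [U1y _] := VU _ Vy.
  have : filtration_step omega W y v by rewrite FK.
  move=> /(filtration_step_sub omega_smooth omega_inj sW) Wv.
  have [_ /(_ v Wv)[a ->]] := fe y U1y; exists (\row_i a i).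
  by apply: eq_bigr => i _; rewrite mxE.
(* The number n of rows is left free: a row base of the kernel is inserted first to find that its
   rank is d, and then the smooth frame with d rows. *)
have basisF y (K : {vspace A y}) n (B : 'M[R]_(n, k)) : V y ->
    filtration_step omega W y = [set v | v \in K] -> row_free B ->
    (B :=: kermx (P y))%MS ->
    basis_of K [tuple \sum_i B a i *: e i y | a < n].
  move=> Vy FK fB BP; have [U1y _] := VU _ Vy.
  apply: frame_of_matrix => //; [by have [] := fe y U1y | exact: spanF |].
  move=> w; rewrite BP sub_kermx; split.
    by move=> /eqP/(FP _ _ Vy); rewrite FK.
  by move=> wK; apply/eqP/(FP _ _ Vy); rewrite FK.
have rP y : V y -> \rank (kermx (P y)) = d.
  move=> Vy; have [K dK FK] := Hd y; rewrite -dK.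
  have := basisF y K _ (row_base (kermx (P y))) Vy FK (row_base_free _) (eq_row_base _).
  by move=> /size_basis ->.
have [V' [B [oV' V'x V'V sB BP]]] := smooth_kernel_frame oV Vx sP rP.
exists V', (fun y => [tuple \sum_i B y a i *: e i y | a < d]); split=> //.
  move=> a; apply/(smooth_push omega_smooth omega_inj _ oV').
  apply: (@smoothv_on_eq _ _ _ _ (fun y => \sum_i B y a i *: push (e i) y)) => //.
    by move=> y _; rewrite /push tnth_mktuple omega_comb.
  apply: smoothv_on_sum => // i; apply: smoothv_onZ => //;
    exact: smoothv_on_subset (spe i).
move=> y V'y; have [fB BK] := BP y V'y; have [K _ FK] := Hd y.
have /andP[/eqP spB ->] := basisF y K _ (B y) (V'V _ V'y) FK fB BK; split=> //.
by rewrite FK spB.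
Qed.

End FiltrationStep.

(** * Brackets and the isotropy subalgebroid *)

Section LieAlgebra.
Variables (R : realType) (G : lie_group R) (g : lie_algebra G).
Implicit Types (a : R) (v w z : g) (f : G -> R).

Let vf_tangent v y : is_tangent y (la_vf v y).
Proof. by have [[+ _] _] := la_vf_invariant v; exact. Qed.

Let vf_smooth v f : smoothf f -> smoothf (fun y => la_vf v y f).
Proof. by have [[_ +] _] := la_vf_invariant v; exact. Qed.

Lemma la_vf_ext v w : (forall y f, smoothf f -> la_vf v y f = la_vf w y f) -> v = w.
Proof.
move=> H; apply/eqP; rewrite -subr_eq0; apply/eqP; apply: la_vf_inj => y f sf.
by rewrite addrC -scaleN1r la_vf_linear// H// mulN1r addNr.
Qed.

(** The bracket is given only through commutators of right-invariant fields, so its algebraic laws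
    are verified on those fields and transferred by [la_vf_ext]. *)
Lemma la_br_linear_l a v w z : la_br (a *: v + w) z = a *: la_br v z + la_br w z.
Proof.
apply: la_vf_ext => y f sf; rewrite la_vf_linear// !la_vf_br// la_vf_linear;
  last exact: vf_smooth.
rewrite (_ : (fun _ => la_vf (_ + _) _ _) = fun x => a * la_vf v x f + la_vf w x f).
  by rewrite (vf_tangent z y).1; [ring | exact: vf_smooth | exact: vf_smooth].
by apply/funext => x; rewrite la_vf_linear.
Qed.

Lemma la_br_linear_r a v w z : la_br z (a *: v + w) = a *: la_br z v + la_br z w.
Proof.
apply: la_vf_ext => y f sf; rewrite la_vf_linear// !la_vf_br// la_vf_linear;
  last exact: vf_smooth.
rewrite (_ : (fun _ => la_vf (_ + _) _ _) = fun x => a * la_vf v x f + la_vf w x f).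
  by rewrite (vf_tangent z y).1; [ring | exact: vf_smooth | exact: vf_smooth].
by apply/funext => x; rewrite la_vf_linear.
Qed.

Lemma la_brDl v w z : la_br (v + w) z = la_br v z + la_br w z.
Proof. by rewrite -[v]scale1r la_br_linear_l !scale1r. Qed.

Lemma la_brDr v w z : la_br z (v + w) = la_br z v + la_br z w.
Proof. by rewrite -[v]scale1r la_br_linear_r !scale1r. Qed.

Lemma la_brBl v w z : la_br (v - w) z = la_br v z - la_br w z.
Proof. by rewrite addrC -scaleN1r la_br_linear_l scaleN1r addrC. Qed.

Lemma la_br_jacobi v w z :
  la_br (la_br v w) z = la_br v (la_br w z) - la_br w (la_br v z).
Proof.
apply: la_vf_ext => y f sf; rewrite addrC -scaleN1r la_vf_linear// !la_vf_br//;
  try exact: vf_smooth.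
have brE p q : (fun x => la_vf (la_br p q) x f) =
    fun x => la_vf p x (fun t => la_vf q t f) - la_vf q x (fun t => la_vf p t f).
  by apply/funext => x; rewrite la_vf_br.
rewrite !brE !(tangentB (vf_tangent _ y)); try by do 2 apply: vf_smooth.
ring.
Qed.

End LieAlgebra.

(** * Closure under brackets, the fundamental representation and isotropy *)

Section Filtration.
Variables (R : realType) (G : lie_group R) (g : lie_algebra G) (S : manifold R).
Variables (A : lie_algebroid S) (omega : forall x, 'Hom(A x, g)).
Hypothesis omega_morphism : is_algebroid_morphism omega.
Hypothesis omega_inj : forall x, injective (omega x).
Hypothesis A_transitive : is_transitive A.

Let oT := @openT S.
Let omega_smooth := omega_morphism.1.
Local Notation push := (push omega).

Let spush (X : sect A) : smooth_sect X -> smoothv_on setT (push X).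
Proof. by move=> sX; exact/smooth_sect_push. Qed.

Let sflat (X : sect A) (s : S -> g) : smooth_sect X ->
  smoothv_on setT s -> smoothv_on setT (fun x => flat (anchor (X x)) s).
Proof. exact: smooth_flat_anchor. Qed.

Let sbr (s t : S -> g) : smoothv_on setT s -> smoothv_on setT t ->
  smoothv_on setT (fun y => la_br (s y) (t y)).
Proof.
by apply: smoothv_on_bilinear;
  [exact: la_br_linear_l|exact: la_br_linear_r|exact: openT].
Qed.

Lemma flat_br x u (s t : S -> g) : is_tangent x u ->
  smoothv_on setT s -> smoothv_on setT t ->
  flat u (fun y => la_br (s y) (t y)) = la_br (flat u s) (t x) + la_br (s x) (flat u t).
Proof. by apply: flat_bilinear; [exact: la_br_linear_l|exact: la_br_linear_r]. Qed.

Lemma push_br (X Y : sect A) x : smooth_sect X -> smooth_sect Y ->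
  push (ad_br X Y) x = flat (anchor (X x)) (push Y) - flat (anchor (Y x)) (push X)
    + la_br (push X x) (push Y x).
Proof. by move=> sX sY; have [_ H] := omega_morphism; exact: H. Qed.

(** Flatness of nabla: the anchor carries brackets to commutators, applied to each coordinate of
    s. *)
Lemma flat_anchor_br (X Y : sect A) (s : S -> g) x : smooth_sect X -> smooth_sect Y ->
  smoothv_on setT s ->
  flat (anchor (ad_br X Y x)) s =
    flat (anchor (X x)) (fun y => flat (anchor (Y y)) s) -
    flat (anchor (Y x)) (fun y => flat (anchor (X y)) s).
Proof.
move=> sX sY ss; apply: coord_inj => i; rewrite linearB /= !coord_flat.
rewrite anchor_br//; last exact: ss.
have E (Z : sect A) : (fun y => coord (vbasis {:g}) i (flat (anchor (Z y)) s)) =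
    fun y => anchor (Z y) (fun t => coord (vbasis {:g}) i (s t)).
  by apply/funext => y; exact: coord_flat.
by rewrite !E.
Qed.

Lemma filtration_step_sect (W : subfamily A) (X : sect A) : is_subbundle W ->
  sect_in (filtration_step omega W) X -> sect_in W X.
Proof.
by move=> sW [sX FX]; split=> // x;
  exact: (filtration_step_sub omega_smooth omega_inj sW).
Qed.

(** Makes the derivative of X a genuine global section P of W, which can then be bracketed with
    sections of W. Its values are chosen pointwise; smoothness follows because [push P] is
    smooth. *)
Lemma filtration_step_derivative (W : subfamily A) (X B : sect A) : is_subbundle W ->
  sect_in (filtration_step omega W) X -> smooth_sect B ->
  exists2 P : sect A, sect_in W P & push P = fun y => flat (anchor (B y)) (push X).
Proof.
move=> sW FX sB; have WX := filtration_step_sect sW FX.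
have H y : exists v : A y, W y v /\ omega y v = flat (anchor (B y)) (push X).
  have [_ /(_ y)/(filtration_stepP omega_smooth omega_inj _ sW)[_ HX]] := FX.
  by have [v Wv vE] := HX X WX erefl _ (anchor_tangent (B y)); exists v.
pose P y := sval (cid (H y)).
have PE : push P = fun y => flat (anchor (B y)) (push X).
  by apply/funext => y; exact: (svalP (cid (H y))).2.
exists P => //; split; last by move=> y; exact: (svalP (cid (H y))).1.
apply/(smooth_sect_push omega_smooth omega_inj); rewrite PE.
by apply: sflat => //; apply: spush; have [] := FX.
Qed.

(* With P = nabla_{#B} X and Q = nabla_{#B} Y for a section B of A, flatness of
   nabla gives nabla_{#B} [X, Y] = [X, Q] + [P, Y] modulo W, the remaining terms
   being derivatives of the sections X and Y of the next term. *)
Lemma filtration_step_br (W : subfamily A) : is_subalgebroid W ->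
  forall X Y, sect_in (filtration_step omega W) X ->
    sect_in (filtration_step omega W) Y ->
    sect_in (filtration_step omega W) (ad_br X Y).
Proof.
move=> [sW brW] X Y FX FY.
have WX := filtration_step_sect sW FX; have WY := filtration_step_sect sW FY.
have WZ := brW X Y WX WY; have [[sX _] [sY _] [sZ _]] := And3 WX WY WZ.
split=> // x; exists (ad_br X Y); split=> // u tu.
have [a _ au] := A_transitive tu.
have [B [sB _] Ba] := subbundle_extension omega_smooth omega_inj (full_subbundle A)
  (I : [set: A x] a).
have [P WP PE] := filtration_step_derivative sW FX sB.
have [Q WQ QE] := filtration_step_derivative sW FY sB.
have [sP _] := WP; have [sQ _] := WQ.
have [spX spY] := (spush sX, spush sY).
rewrite -(eq_flat (spush sZ) au) -Ba.
have tB := anchor_tangent (B x).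
have dX (c : A x) : omega_image omega W x (flat (anchor c) (push X)).
  have [_ /(_ x)/(filtration_stepP omega_smooth omega_inj _ sW)[_ HX]] := FX.
  exact: HX (anchor_tangent _).
have dY (c : A x) : omega_image omega W x (flat (anchor c) (push Y)).
  have [_ /(_ x)/(filtration_stepP omega_smooth omega_inj _ sW)[_ HY]] := FY.
  exact: HY (anchor_tangent _).
have WL (T T' : sect A) : sect_in W T -> sect_in W T' ->
    omega_image omega W x (push (ad_br T T') x).
  by move=> WT WT'; exists (ad_br T T' x) => //; have [] := brW _ _ WT WT'.
(* Nested in the shape a *: v + w that [omega_image_linear] consumes: two brackets of sections of W,
   then four derivatives of X or Y. The last two of these come from commuting nabla along B with
   nabla along X and Y. *)
have -> : flat (anchor (B x)) (push (ad_br X Y)) =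
    1 *: push (ad_br X Q) x + (1 *: push (ad_br P Y) x
    + (1 *: flat (anchor (Q x)) (push X) + (-1 *: flat (anchor (P x)) (push Y)
    + (1 *: flat (anchor (ad_br B X x)) (push Y)
    + (-1 *: flat (anchor (ad_br B Y x)) (push X) + 0))))); last first.
  do 2 (apply: omega_image_linear => //; first exact: WL).
  do 4 (apply: omega_image_linear => //).
  by exists 0; [exact: subbundle0 | rewrite linear0].
rewrite (_ : push (ad_br X Y) = fun y =>
   (flat (anchor (X y)) (push Y) - flat (anchor (Y y)) (push X))
   + la_br (push X y) (push Y y)); last by apply/funext => y; exact: push_br.
rewrite (flatD tB); [|by apply: smoothv_onB => //; exact: sflat|exact: sbr].
rewrite (flatB tB); [|exact: sflat|exact: sflat].
rewrite (flat_br tB)// !push_br// !flat_anchor_br// -PE -QE.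
have -> : flat (anchor (B x)) (push X) = push P x by rewrite PE.
have -> : flat (anchor (B x)) (push Y) = push Q x by rewrite QE.
rewrite !scale1r !scaleN1r.
move: (flat (anchor (X x)) (push Q)) (flat (anchor (Q x)) (push X))
  (la_br (push X x) (push Q x)) (flat (anchor (P x)) (push Y))
  (flat (anchor (Y x)) (push P)) (la_br (push P x) (push Y x))
  (flat (anchor (B x)) (fun y => flat (anchor (X y)) (push Y)))
  (flat (anchor (B x)) (fun y => flat (anchor (Y y)) (push X))) =>
  a1 a2 a3 a4 a5 a6 a7 a8.
apply: coord_inj => i; rewrite !(linearD, linearN, linear0) /=; ring.
Qed.

(** The axioms hold over all of A, hence over each W. Compatibility with brackets combines flatness
    of nabla, the Leibniz rule for the bracket of g and the Jacobi identity; the mixed terms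
    cancel. *)
Lemma fundamental_rep_represents (W : subfamily A) :
  represents W (fundamental_rep omega).
Proof.
have smt (xi : sect (trivial_bundle S g)) : smooth_sect xi -> smoothv_on setT xi.
  by move/smooth_sect_on_trivial.
rewrite /fundamental_rep; split.
- move=> X xi [sX _] /smt sxi; apply/smooth_sect_on_trivial.
  apply: smoothv_onD => //; first exact: sflat.
  by apply: sbr => //; exact: spush.
- move=> x c a b xi _ _ /smt sxi.
  rewrite flat_anchor_linear// linearP la_br_linear_l scalerDr.
  by rewrite -!addrA; congr (_ + _); rewrite addrCA.
- move=> x b xi eta _ /smt sxi /smt seta.
  rewrite (flatD (anchor_tangent b))// la_brDr.
  by rewrite -!addrA; congr (_ + _); rewrite addrCA.
- move=> x b f xi _ sf /smt sxi.
  rewrite (flatZ (anchor_tangent b))//.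
  have -> : la_br (omega x b) (f x *: xi x) = f x *: la_br (omega x b) (xi x).
    have := la_br_linear_r (f x) (xi x) 0 (omega x b).
    have := la_br_linear_r (-1) 0 0 (omega x b).
    by rewrite scaler0 addr0 scaleN1r addNr => ->; rewrite !addr0.
  by rewrite scalerDr -!addrA; congr (_ + _); rewrite addrC.
- move=> X Y xi [sX _] [sY _] /smt sxi x.
  have [tX tY] := (anchor_tangent (X x), anchor_tangent (Y x)).
  have [spX spY] := (spush sX, spush sY).
  rewrite flat_anchor_br// -/(push (ad_br X Y) x) push_br//.
  rewrite (flatD tX) ?(flatD tY); try exact: sflat; try exact: sbr.
  rewrite (@flat_br _ _ (push Y) xi tX)// (@flat_br _ _ (push X) xi tY)//.
  rewrite -/(push X x) -/(push Y x) !la_brDr la_brDl la_brBl la_br_jacobi.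
  apply: coord_inj => i; rewrite !(linearD, linearN) /=; ring.
Qed.

Lemma fundamental_rep_push (X Y : sect A) x : smooth_sect X -> smooth_sect Y ->
  fundamental_rep omega x (X x) (push Y) =
    push (ad_br X Y) x + flat (anchor (Y x)) (push X).
Proof.
by move=> sX sY; rewrite push_br// addrAC subrK.
Qed.

Lemma filtration_step_isotropy (W : subfamily A) x : is_subalgebroid W ->
  transitive_on W -> filtration_step omega W x =
    isotropy W (fundamental_rep omega) (omega_image omega W) x.
Proof.
move=> [sW brW] tW; apply/seteqP; split=> b.
  move=> [X [WX Xb HX]]; split; first by rewrite -Xb; have [] := WX.
  move=> eta [/smooth_sect_on_trivial seta Weta].
  (* A section of the image of W is lifted pointwise; the lift is smooth since its image under
     [omega] is eta. *)
  pose Y y := sval (cid2 (Weta y)).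
  have YE : push Y = eta by apply/funext => y; exact: (s2valP' (cid2 (Weta y))).
  have sY : smooth_sect Y by apply/(smooth_sect_push omega_smooth omega_inj);
    rewrite YE.
  have WY : sect_in W Y by split=> // y; exact: (s2valP (cid2 (Weta y))).
  have [sX _] := WX.
  rewrite -YE -Xb fundamental_rep_push// -[push _ x]scale1r.
  apply: omega_image_linear => //; last exact: HX (anchor_tangent _).
  by exists (ad_br X Y x) => //; have [] := brW _ _ WX WY.
move=> [Wb Hb]; have [X WX Xb] := subbundle_extension omega_smooth omega_inj sW Wb.
have [sX _] := WX.
exists X; split=> // u tu; have [c Wc cu] := tW _ _ tu.
have [Y WY Yc] := subbundle_extension omega_smooth omega_inj sW Wc.
have [sY WYy] := WY.
rewrite -(eq_flat (spush sX) cu) -Yc.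
have : omega_image omega W x (fundamental_rep omega x b (push Y)).
  apply: Hb; split; first by apply/smooth_sect_on_trivial; exact: spush.
  by move=> y; exists (Y y).
rewrite -Xb fundamental_rep_push// => HD.
rewrite -[flat _ _](addKr (push (ad_br X Y) x)) -scaleN1r.
apply: omega_image_linear => //.
by exists (ad_br X Y x) => //; have [] := brW _ _ WX WY.
Qed.

End Filtration.

Theorem proposition3p7 (R : realType) (G : lie_group R) (g : lie_algebra G)
    (M : klein_geometry G) (Sigma : manifold R)
    (Sigma_connected : connected [set: Sigma])
    (A : lie_algebroid Sigma) (omega : forall x : Sigma, 'Hom(A x, g))
    (omega_immersion : is_infinitesimal_immersion M omega)
    (filtration_rank : forall j : nat, (1 <= j)%N ->
       constant_rank (invariant_filtration omega j))
    (j : nat) (j_ge1 : (1 <= j)%N) :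
  is_subalgebroid (invariant_filtration omega j) /\
  (transitive_on (invariant_filtration omega j) ->
     represents (invariant_filtration omega j) (fundamental_rep omega) /\
     is_subalgebroid (invariant_filtration omega j.+1) /\
     forall x : Sigma,
       invariant_filtration omega j.+1 x =
       isotropy (invariant_filtration omega j) (fundamental_rep omega)
         (omega_image omega (invariant_filtration omega j)) x).
Proof.
have [mor tA inj _ _] := omega_immersion.
have stepE n : invariant_filtration omega n.+2 =
  filtration_step omega (invariant_filtration omega n.+1) by [].
(* Subbundle and bracket closure are carried together, as [filtration_step_br] uses both for the
   preceding term. Writing the index as n.+1 leaves out the dummy value at 0. *)
have sub n : is_subalgebroid (invariant_filtration omega n.+1).
  elim: n => [|n IH].
    split; first exact: full_subbundle.
    by move=> X Y [sX _] [sY _]; split=> //; exact: ad_br_smooth.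
  rewrite stepE; split; last exact: filtration_step_br.
  apply: filtration_step_subbundle => //; [exact: mor.1 | by have [] := IH |].
  exact: (filtration_rank n.+2).
case: j j_ge1 => // n _; split=> // tn; split; first exact: fundamental_rep_represents.
by split=> // x; rewrite stepE; exact: filtration_step_isotropy.
Qed.
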